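(* Let $V$ be a complex vector space of dimension $N+1$ and let $X\subset\mathbb P V=\mathbb P^N$ be an irreducible projective variety of dimension $n$ not contained in a hyperplane. Then for all $p\in\mathbb P V$, $R_X(p)\le N+1-n$.
   Context: For a variety $X\subset\mathbb P V$ and $p\in\mathbb P V$, the $X$-rank $R_X(p)$ is the smallest $r$ such that there exist $x_1,\dots,x_r\in X$ with $p$ in the projective linear span $\mathbb P\langle x_1,\dots,x_r\rangle$. *)

(* Defs.v *)
From HB Require Import structures.
From mathcomp Require Import all_boot all_order all_algebra.
From mathcomp Require Import classical_sets reals.
From mathcomp Require Import complex.
From mathcomp Require Import mpoly.

Set Implicit Arguments.
Unset Strict Implicit.
Unset Printing Implicit Defensive.

Import GRing.Theory.

Local Open Scope ring_scope.
Local Open Scope classical_set_scope.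

Section ProjectiveGeometry.
Context {F : fieldType} {V : vectType F}.

(* The points of PV are the lines through the origin of V. *)
Record proj : Type := ProjPoint {
  line :> {vspace V};
  _ : \dim line == 1%N }.

HB.instance Definition _ := [isSub for line].
HB.instance Definition _ := [Choice of proj by <:].

(* Polynomial functions on V are polynomials in the coordinates with respect
   to the library's chosen basis of V; a linear change of basis preserves
   homogeneity, so the closed sets below do not depend on this choice. *)
Definition peval (f : {mpoly F[\dim {:V}]}) (v : V) : F :=
  f.@[fun i => coord (vbasis {:V}) i v].

(* A form vanishes at a point of PV when it is zero on the whole line. *)
Definition vanishes_at (f : {mpoly F[\dim {:V}]}) (l : proj) : Prop :=
  forall v : V, v \in (l : {vspace V}) -> peval f v = 0.

(* The forms in S may have different degrees. *)
Definition zariski_closed (X : set proj) : Prop :=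
  exists S : set {mpoly F[\dim {:V}]},
    (forall f, S f -> exists d : nat, f \is d.-homog) /\
    X = [set l | forall f, S f -> vanishes_at f l].

Definition irreducible_closed (X : set proj) : Prop :=
  [/\ zariski_closed X,
      X !=set0 &
      forall A B : set proj, zariski_closed A -> zariski_closed B ->
        X = A `|` B -> X = A \/ X = B].

(* Z 0 `<` Z 1 `<` ... `<` Z m; the values of Z beyond m are irrelevant. *)
Definition irreducible_chain (X : set proj) (m : nat) : Prop :=
  exists Z : nat -> set proj,
    (forall i, (i <= m)%N -> irreducible_closed (Z i) /\ Z i `<=` X) /\
    (forall i, (i < m)%N -> Z i `<` Z i.+1).

(* Krull dimension, for X closed: the closed subsets of X in the induced
   topology are then the closed subsets of PV contained in X. *)
Definition has_dimension (X : set proj) (n : nat) : Prop :=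
  irreducible_chain X n /\
  (forall m, irreducible_chain X m -> (m <= n)%N).

Definition in_hyperplane (X : set proj) : Prop :=
  exists W : {vspace V},
    (\dim W).+1 = \dim {:V} /\ forall x, X x -> (x <= W)%VS.

(* The projective linear span P<x_1, ..., x_r> is the set of lines contained in
   the sum of the lines x_i; the x_i need not be distinct. *)
Definition spanned_by (X : set proj) (p : proj) (r : nat) : Prop :=
  exists x : 'I_r -> proj,
    (forall i, X (x i)) /\ (p <= \sum_(i < r) x i)%VS.

(* r is the X-rank of p; as a relation, it has no junk value when p is not in
   the linear span of X. *)
Definition is_Xrank (X : set proj) (p : proj) (r : nat) : Prop :=
  spanned_by X p r /\ (forall s, spanned_by X p s -> (r <= s)%N).

End ProjectiveGeometry.

Arguments proj {F} V.

(* Main.v *)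
Require Import Defs.
From HB Require Import structures.
From mathcomp Require Import all_boot all_order all_algebra.
From mathcomp Require Import boolp classical_sets reals.
From mathcomp Require Import complex.
From mathcomp Require Import mpoly.
From mathcomp Require Import ring_quotient generic_quotient fraction ring.

(* The variety is handled through a generic point xi of its affine cone, a vector
   over the fraction field of the homogeneous coordinate ring; its points are the
   specializations of xi. Choose coordinates with p = e0. If p is not on X, pick a
   general point a of X and consider the line joining a and p. Either it meets X
   again, and p is spanned by two points; or it meets X at a only, transversally
   since in characteristic 0 the point p is not in all tangent spaces. In the
   second case p stays outside the closure of the projection X' of X from a, and
   X' is nondegenerate of the same dimension in a projective space of dimension
   one less. By induction p is spanned by general points of X'; these lift to X,
   and a is added to their lifts. The second case cannot go on forever: as p is
   not on X, the dimension of X is less than that of the ambient space.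

   The dimension is used only through a chain of irreducible closed subsets: forms
   vanishing on a member of the chain but not on the next one are algebraically
   independent on X. *)

Set Implicit Arguments.
Unset Strict Implicit.
Unset Printing Implicit Defensive.

Import GRing.Theory.

Local Open Scope ring_scope.
Local Open Scope classical_set_scope.
Local Open Scope complex_scope.

(** * The residue field of a prime ideal *)

Section DomainInverse.
Variable D : comNzRingType.
Hypothesis mulD_eq0 : forall x y : D, x * y = 0 -> (x == 0) || (y == 0).

(** The fraction field is formed over an integral domain with decidable units and an inverse
    function; classical choice supplies both for an abstract domain. *)
Definition dom_unit : {pred D} := fun x => `[< exists y, y * x = 1 >].
Definition dom_inv (x : D) : D :=
  if pselect (exists y, y * x = 1) is left ex then sval (cid ex) else x.

Lemma dom_mulVr : {in dom_unit, left_inverse 1 dom_inv *%R}.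
Proof.
move=> x /asboolP ux; rewrite /dom_inv; case: pselect => // ex.
by case: (cid ex).
Qed.

Lemma dom_unitPl x y : y * x = 1 -> x \in dom_unit.
Proof. by move=> e; apply/asboolP; exists y. Qed.

Lemma dom_invr_out : {in [predC dom_unit], dom_inv =1 id}.
Proof.
move=> x nux; rewrite /dom_inv; case: pselect => // ex.
by case/negP: nux; apply/asboolP.
Qed.

Definition dom_type : Type := D.
HB.instance Definition _ := GRing.ComNzRing.on dom_type.
HB.instance Definition _ :=
  GRing.ComNzRing_hasMulInverse.Build dom_type dom_mulVr dom_unitPl dom_invr_out.
HB.instance Definition _ := GRing.ComUnitRing_isIntegral.Build dom_type mulD_eq0.

Lemma dom_fraction_field : exists (K : fieldType) (ev : {rmorphism D -> K}),
  forall x, (ev x == 0) = (x == 0).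
Proof.
pose ev : D -> {fraction dom_type} := @tofrac dom_type.
have evB : zmod_morphism ev by move=> x y; exact: (@tofracB dom_type x y).
have evM : monoid_morphism ev.
  by split=> [|x y]; [exact: (@tofrac1 dom_type) | exact: (@tofracM dom_type x y)].
pose a1 := GRing.isZmodMorphism.Build _ _ ev evB.
pose a2 := GRing.isMonoidMorphism.Build _ _ ev evM.
exists {fraction dom_type}, (HB.pack ev a1 a2 : {rmorphism D -> {fraction dom_type}}).
by move=> x; exact: (@tofrac_eq0 dom_type x).
Qed.
End DomainInverse.

Section PrimeQuotient.
Local Open Scope quotient_scope.
Variables (B : comNzRingType) (I : B -> Prop).
Hypotheses (I0 : I 0) (I1 : ~ I 1) (ID : forall x y, I x -> I y -> I (x + y))
  (IM : forall a x, I x -> I (a * x))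
  (Iprime : forall x y, I (x * y) -> I x \/ I y).

Definition ideal_pred : {pred B} := fun x => `[< I x >].

Lemma ideal_pred_closed : idealr_closed ideal_pred.
Proof.
split; [exact/asboolP | exact/asboolP |].
by move=> a x y /asboolP Ix /asboolP Iy; apply/asboolP/ID => //; apply: IM.
Qed.

HB.instance Definition _ := isIdealr.Build B ideal_pred ideal_pred_closed.

Lemma ideal_pred_prime : prime_idealr_closed ideal_pred.
Proof.
by move=> x y /asboolP /Iprime[Ix|Iy]; apply/orP; [left|right]; exact/asboolP.
Qed.

HB.instance Definition _ := isPrimeIdealrClosed.Build B ideal_pred ideal_pred_prime.

(** The quotient by a prime ideal is a domain and embeds in its fraction field. Applied to the ideal
    of a variety, this gives the field containing the coordinates of the generic point. *)
Lemma prime_ideal_field : exists (K : fieldType) (ev : {rmorphism B -> K}),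
  forall x, ev x = 0 <-> I x.
Proof.
pose Q := {ideal_quot ideal_pred}.
have [K [f fK]] := dom_fraction_field (@Quotient.rquot_IdomainAxiom B ideal_pred).
pose pi : {rmorphism B -> Q} := \pi_Q.
exists K, (f \o pi) => x.
rewrite -[_ x]/(f (pi x)).
have piE : (pi x == 0) = `[< I x >].
  by rewrite -(rmorph0 pi) -[RHS]/(x \in ideal_pred) -{2}(subr0 x) Quotient.idealrBE.
by split=> [/eqP|Ix]; [|apply/eqP]; rewrite fK piE => *; exact/asboolP.
Qed.
End PrimeQuotient.

(** * Substitution in multivariate polynomials *)

Lemma rmorph_mmap n (R : nzRingType) (S T : comNzRingType) (psi : {rmorphism S -> T})
    (j : R -> S) (h : 'I_n -> S) (f : {mpoly R[n]}) :
  psi (mmap j h f) = mmap (psi \o j) (psi \o h) f.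
Proof.
rewrite /mmap rmorph_sum; apply: eq_bigr => m _; rewrite rmorphM; congr (_ * _).
by rewrite /mmap1 rmorph_prod; apply: eq_bigr => i _; rewrite rmorphXn.
Qed.

Lemma eq_mmap n (R S : nzRingType) (j j' : R -> S) (h h' : 'I_n -> S)
    (f : {mpoly R[n]}) : j =1 j' -> h =1 h' -> mmap j h f = mmap j' h' f.
Proof.
move=> ej eh; rewrite /mmap; apply: eq_bigr => m _.
by rewrite ej (mmap1_eq _ eh).
Qed.

Lemma mmapXU n (R S : nzRingType) (j : {rmorphism R -> S}) (h : 'I_n -> S) i :
  mmap j h 'X_i = h i.
Proof. by rewrite mmapX mmap1U. Qed.

Lemma mpoly_ring_ind n (R : nzRingType) (Q : {mpoly R[n]} -> Prop) :
  (forall c, Q c%:MP) -> (forall i, Q 'X_i) ->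
  (forall p q, Q p -> Q q -> Q (p + q)) -> (forall p q, Q p -> Q q -> Q (p * q)) ->
  forall p, Q p.
Proof.
move=> Qc QX QD QM p; rewrite (mpolyE p); apply: (big_ind Q) => //.
  by rewrite -mpolyC0.
move=> m _; rewrite -mul_mpolyC; apply: (QM) => //; rewrite mpolyXE_id.
apply: (big_ind Q) => [|p' q' Qp' Qq'|i _]; [by rewrite -mpolyC1 | exact: QM |].
by elim: (m i) => [|e IHe]; [rewrite expr0 -mpolyC1 | rewrite exprS; exact: QM].
Qed.

Lemma homog_mmap n (R S : comNzRingType) (j : {rmorphism R -> S}) (h : 'I_n -> S)
    (c : S) d (f : {mpoly R[n]}) :
  f \is d.-homog -> mmap j (fun i => c * h i) f = c ^+ d * mmap j h f.
Proof.
move/dhomogP => hom; rewrite /mmap mulr_sumr !big_seq; apply: eq_bigr => m fm.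
rewrite mulrCA; congr (_ * _); rewrite /mmap1.
have <- : mdeg m = d := hom m fm.
rewrite mdegE -prodrXr -big_split /=.
by apply: eq_bigr => i _; rewrite exprMn.
Qed.

(** Pullback of a polynomial to the parametrized line [a + 'X w]. The coefficients of degree 0 and 1
    are the value and the derivative along [w] at [a]; for a form, the top one is the value at
    [w]. *)
Definition line_subst n (R S : comNzRingType) (j : {rmorphism R -> S}) (a w : 'I_n -> S) :
  {mpoly R[n]} -> {poly S} :=
  mmap (polyC \o j) (fun i => (a i)%:P + w i *: 'X).

HB.instance Definition _ n (R S : comNzRingType) (j : {rmorphism R -> S})
  (a w : 'I_n -> S) := GRing.RMorphism.copy (line_subst j a w)
    (mmap (polyC \o j) (fun i => (a i)%:P + w i *: 'X)).

Section LineSubstitution.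
Variables (n : nat) (R S : comNzRingType) (j : {rmorphism R -> S}).
Variables (a w : 'I_n -> S).
Implicit Type f : {mpoly R[n]}.

Lemma line_substC c : line_subst j a w c%:MP = (j c)%:P.
Proof. by rewrite /line_subst mmapC. Qed.

Lemma line_substX i : line_subst j a w 'X_i = (a i)%:P + w i *: 'X.
Proof. by rewrite /line_subst mmapXU. Qed.

Lemma horner_line_subst f t : (line_subst j a w f).[t] = mmap j (fun i => a i + w i * t) f.
Proof.
rewrite -[LHS]/(horner_eval t (line_subst j a w f)) rmorph_mmap.
apply: eq_mmap => [c|i] /=; rewrite /horner_eval; first by rewrite hornerC.
by rewrite hornerD hornerC hornerZ hornerX.
Qed.

Lemma map_line_subst (T : comNzRingType) (psi : {rmorphism S -> T}) f :
  map_poly psi (line_subst j a w f) = line_subst (psi \o j) (psi \o a) (psi \o w) f.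
Proof.
rewrite rmorph_mmap; apply: eq_mmap => [c|i] /=; first by rewrite map_polyC.
by rewrite rmorphD /= map_polyC map_polyZ /= map_polyX.
Qed.

Lemma line_subst_coef0 f : (line_subst j a w f)`_0 = mmap j a f.
Proof.
rewrite -horner_coef0 horner_line_subst; apply: eq_mmap => // i.
by rewrite mulr0 addr0.
Qed.

(** Degrees are formal, mere bounds on sizes, because the coefficients at [d] and [e] may vanish. *)
Lemma size_coef_mul (p q : {poly S}) d e :
  (size p <= d.+1)%N -> (size q <= e.+1)%N ->
  (size (p * q)%R <= (d + e).+1)%N /\ (p * q)`_(d + e) = p`_d * q`_e.
Proof.
move=> sp sq; split.
  apply: leq_trans (size_polyMleq _ _) _.
  by rewrite -subn1 leq_subLR add1n -addSn -addnS leq_add.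
have ltd : (d < (d + e).+1)%N by rewrite ltnS leq_addr.
rewrite coefM (bigD1 (Ordinal ltd)) //=.
rewrite addKn big1 ?addr0 // => i; rewrite -val_eqE /= => neid.
have [lt|le] := ltnP d i; first by rewrite nth_default ?mul0r // (leq_trans sp).
rewrite [q`__]nth_default ?mulr0 // (leq_trans sq) //.
have {}lt : (i < d)%N by rewrite ltn_neqAle neid.
by rewrite ltn_subRL ltn_add2r.
Qed.

Lemma line_subst_top f d : f \is d.-homog ->
  (size (line_subst j a w f) <= d.+1)%N /\ (line_subst j a w f)`_d = mmap j w f.
Proof.
move=> /dhomogP hom.
(* [T q e c] reads: [q] has formal degree [e], with coefficient [c] there. It is stable under
   products, so it passes from linear polynomials to monomials. *)
pose T (q : {poly S}) e c := (size q <= e.+1)%N /\ q`_e = c.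
have TM q q' e e' c c' : T q e c -> T q' e' c' -> T (q * q') (e + e')%N (c * c').
  by move=> [s1 <-] [s2 <-]; exact: size_coef_mul.
rewrite -/(T _ d _) /line_subst /mmap !big_seq.
apply: (big_rec2 (fun q c => T q d c)); first by split; rewrite ?size_poly0 ?coef0.
move=> m c q fm [s1 e1].
have [s2 e2] : T ((polyC \o j) f@_m * mmap1 (fun i => (a i)%:P + w i *: 'X) m) (0 + d)%N
    (j f@_m * mmap1 w m).
  apply: (TM); first by split; rewrite /= ?coefC // size_polyC; case: eqP.
  have <- : mdeg m = d := hom m fm.
rewrite mdegE /mmap1.
  apply: (big_rec3 (fun q e c => T q e c)).
    by split; rewrite ?size_poly1 // coefC.
  move=> i q1 e3 c3 _; apply: (TM).
  have Ti : T ((a i)%:P + w i *: 'X) 1 (w i).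
    split; last by rewrite coefD coefC coefZ coefX mulr1 add0r.
    apply: leq_trans (size_polyD _ _) _; rewrite geq_max.
    rewrite (leq_trans (size_polyC_leq1 _)) //.
    by rewrite (leq_trans (size_scale_leq _ _)) // size_polyX.
  elim: (m i) => [|e IHe]; first by split; rewrite ?size_poly1 // coefC.
  by rewrite !exprS; exact: (TM _ _ 1 e).
split; last by rewrite coefD e1 e2.
by apply: leq_trans (size_polyD _ _) _; rewrite geq_max s1 s2.
Qed.

End LineSubstitution.

(** Both sides are additive and obey the Leibniz rule, so constants and variables suffice. *)
Lemma line_subst_coef1 n (R S : comNzRingType) (j : {rmorphism R -> S}) (a : 'I_n -> R)
    (w : 'I_n -> S) (f : {mpoly R[n]}) :
  (line_subst j (j \o a) w f)`_1 = \sum_i j (f^`M(i)).@[a] * w i.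
Proof.
elim/mpoly_ring_ind: f => [c|i|p q IHp IHq|p q IHp IHq].
- rewrite line_substC coefC big1 // => i _.
  by rewrite mderivC meval0 rmorph0 mul0r.
- rewrite line_substX coefD coefC coefZ coefX mulr1 add0r (bigD1 i) //= big1 ?addr0.
    rewrite mderivX mevalZ mnm1E eqxx.
    have -> : (U_(i) - U_(i) = 0 :> 'X_{1..n})%MM by apply/mnmP=> l; rewrite mnmBE mnm0E subnn.
    by rewrite mpolyX0 meval1 mulr1 rmorph1 mul1r.
  move=> l neil; rewrite mderivX mnm1E eq_sym (negbTE neil) scale0r meval0.
  by rewrite rmorph0 mul0r.
- rewrite rmorphD coefD IHp IHq -big_split /=; apply: eq_bigr => i _.
  by rewrite mderivD mevalD rmorphD mulrDl.
- rewrite rmorphM coefM !big_ord_recl big_ord0 /= addr0 IHp IHq !line_subst_coef0.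
  have e h : mmap j (j \o a) h = j h.@[a].
    by rewrite /meval rmorph_mmap; apply: eq_mmap.
  rewrite !e mulr_sumr mulr_suml -big_split /=; apply: eq_bigr => i _.
  rewrite mderivM mevalD !mevalM rmorphD !rmorphM mulrDl addrC.
  by congr (_ + _); rewrite ?mulrA // mulrAC.
Qed.

(** * Algebraic dependence *)

Section AlgebraicClosure.
Variables (k : nzRingType) (K : fieldType) (iota : {rmorphism k -> K}).
Implicit Types (S T : K -> Prop) (x y z : K) (q : {poly K}).

Inductive rgen S : K -> Prop :=
| rgen_const c : rgen S (iota c)
| rgen_mem x : S x -> rgen S x
| rgen_add x y : rgen S x -> rgen S y -> rgen S (x + y)
| rgen_mul x y : rgen S x -> rgen S y -> rgen S (x * y).

Definition rgen_poly S q := forall i, rgen S q`_i.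

(** Algebraicity over the field [k(S)], with denominators cleared: the coefficients lie in the ring
    [k[S]] generated by [S]. *)
Definition acl S z := exists q, [/\ q != 0, rgen_poly S q & root q z].

Lemma rgen0 S : rgen S 0.
Proof. by rewrite -(rmorph0 iota); exact: rgen_const. Qed.

Lemma rgen1 S : rgen S 1.
Proof. by rewrite -(rmorph1 iota); exact: rgen_const. Qed.

Lemma rgenN S x : rgen S x -> rgen S (- x).
Proof.
move=> Sx; rewrite -mulN1r; apply: rgen_mul => //.
by rewrite -(rmorphN1 iota); exact: rgen_const.
Qed.

Lemma rgen_exp S x n : rgen S x -> rgen S (x ^+ n).
Proof.
move=> Sx; elim: n => [|n IHn]; first by rewrite expr0; exact: rgen1.
by rewrite exprS; exact: rgen_mul.
Qed.

Lemma rgen_sum S (I : Type) (r : seq I) (P : pred I) (F : I -> K) :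
  (forall i, P i -> rgen S (F i)) -> rgen S (\sum_(i <- r | P i) F i).
Proof.
by move=> SF; apply: (big_ind (rgen S)) => //; [exact: rgen0 | exact: rgen_add].
Qed.

Lemma rgen_sub S T : (forall x, S x -> rgen T x) -> forall x, rgen S x -> rgen T x.
Proof.
move=> ST x; elim=> [c|y /ST //|y z _ Ty _ Tz|y z _ Ty _ Tz].
- exact: rgen_const.
- exact: rgen_add.
- exact: rgen_mul.
Qed.

(** * The subfield generated by a set of elements *)

Section FractionSubfield.
Variable S : K -> Prop.

Definition rfrac : {pred K} :=
  fun x => `[< exists a b, [/\ rgen S a, rgen S b, b != 0 & x = a / b] >].

Lemma rfrac_rgen x : rgen S x -> x \in rfrac.
Proof.
move=> Sx; apply/asboolP; exists x, 1; split=> //; last by rewrite divr1.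
- exact: rgen1.
- exact: oner_neq0.
Qed.

Lemma rfrac_closed : divring_closed rfrac.
Proof.
split; first exact/rfrac_rgen/rgen1.
- move=> _ _ /asboolP[a [b [Sa Sb b0 ->]]] /asboolP[c [d [Sc Sd d0 ->]]].
  apply/asboolP; exists (a * d - c * b), (b * d); split.
  + by apply: rgen_add; [|apply: rgenN]; exact: rgen_mul.
  + exact: rgen_mul.
  + by rewrite mulf_neq0.
  + by rewrite -mulNr addf_div // mulNr.
- move=> _ _ /asboolP[a [b [Sa Sb b0 ->]]] /asboolP[c [d [Sc Sd d0 ->]]].
  have [->|c0] := eqVneq c 0; first by rewrite mul0r invr0 mulr0; exact/rfrac_rgen/rgen0.
  apply/asboolP; exists (a * d), (b * c); split; rewrite ?mulf_neq0 //.
  + exact: rgen_mul.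
  + exact: rgen_mul.
  + by rewrite invf_div mulf_div.
Qed.

HB.instance Definition _ := GRing.isDivringClosed.Build K rfrac rfrac_closed.

Record rfield := RField { rfield_val :> K; _ : rfield_val \in rfrac }.
HB.instance Definition _ := [isSub for rfield_val].
HB.instance Definition _ := [Choice of rfield by <:].
HB.instance Definition _ := [SubChoice_isSubComUnitRing of rfield by <:].
HB.instance Definition _ := [SubComUnitRing_isSubIntegralDomain of rfield by <:].
HB.instance Definition _ := [SubIntegralDomain_isSubField of rfield by <:].

Definition rfield_inc : {rmorphism rfield -> K} := val.

Lemma common_denominator (p : {poly rfield}) :
  exists b : K, [/\ rgen S b, b != 0 & rgen_poly S (b *: map_poly rfield_inc p)].
Proof.
elim/poly_ind: p => [|p [c hc] [b [Sb b0 Sp]]].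
  exists 1; split; [exact: rgen1 | exact: oner_neq0 |] => i.
  by rewrite rmorph0 scaler0 coef0; exact: rgen0.
have /asboolP[a [d [Sa Sd d0 cE]]] := hc.
exists (b * d); split; [exact: rgen_mul | by rewrite mulf_neq0 |] => i.
rewrite coefZ coef_map coefD coefMX coefC.
case: i => [|i] /=.
  by rewrite add0r /= cE -mulrA [d * _]mulrC divfK //; exact: rgen_mul.
rewrite addr0 mulrAC; apply: rgen_mul => //.
by move: (Sp i); rewrite coefZ coef_map.
Qed.

(** Clearing denominators turns an equation over [k(S)] into one over [k[S]]; the closure properties
    of algebraic elements then carry over to [acl]. *)
Lemma acl_algebraic z : acl S z <-> algebraicOver rfield_inc z.
Proof.
split=> [[q [q0 Sq qz]]|[p p0 pz]].
  pose p : {poly rfield} := \poly_(i < size q) RField (rfrac_rgen (Sq i)).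
  have pE : map_poly rfield_inc p = q.
    apply/polyP=> i; rewrite coef_map coef_poly.
    by case: ltnP => //= le; rewrite nth_default.
  exists p; last by rewrite pE.
  by apply: contra_neq q0 => p0; rewrite -pE p0 rmorph0.
have [b [Sb b0 Sp]] := common_denominator p.
exists (b *: map_poly rfield_inc p); split=> //; last by rewrite rootZ.
by rewrite scaler_eq0 (negbTE b0) map_poly_eq0.
Qed.

End FractionSubfield.

Lemma acl_mem S x : S x -> acl S x.
Proof.
move=> Sx; apply/acl_algebraic.
have Fx : x \in rfrac S by apply/rfrac_rgen/rgen_mem.
exact: (algebraic_id (rfield_inc S) (RField Fx)).
Qed.

Lemma acl_const S c : acl S (iota c).
Proof.
apply/acl_algebraic.
have Fx : iota c \in rfrac S by apply/rfrac_rgen/rgen_const.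
exact: (algebraic_id (rfield_inc S) (RField Fx)).
Qed.

Lemma acl_add S x y : acl S x -> acl S y -> acl S (x + y).
Proof. by rewrite !acl_algebraic; exact: algebraic_add. Qed.

Lemma acl_mul S x y : acl S x -> acl S y -> acl S (x * y).
Proof. by rewrite !acl_algebraic; exact: algebraic_mul. Qed.

Lemma acl_inv S x : acl S x -> acl S x^-1.
Proof. by rewrite !acl_algebraic; exact: algebraic_inv. Qed.

Lemma acl_trans S T : (forall x, T x -> acl S x) -> forall z, acl T z -> acl S z.
Proof.
move=> TS z [q [q0 Tq qz]]; apply/acl_algebraic/integral_algebraic.
apply: (integral_root q0 qz) => _ /(nthP 0)[i _ <-].
apply/integral_algebraic/acl_algebraic.
by elim: (Tq i) => {i}; [exact: acl_const | exact: TS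
  | move=> *; exact: acl_add | move=> *; exact: acl_mul].
Qed.

Lemma acl_subset S T : (forall x, S x -> T x) -> forall z, acl S z -> acl T z.
Proof. by move=> ST; apply: acl_trans => x /ST; exact: acl_mem. Qed.

(** * The exchange property and transcendence degree *)

Definition adjoin S y : K -> Prop := fun x => S x \/ x = y.

Lemma rgen_adjoin S y x : rgen (adjoin S y) x ->
  exists q, rgen_poly S q /\ x = q.[y].
Proof.
elim=> {x} [c|x [Sx|->]|x1 x2 _ [q1 [S1 ->]] _ [q2 [S2 ->]]
  |x1 x2 _ [q1 [S1 ->]] _ [q2 [S2 ->]]].
- exists (iota c)%:P; rewrite hornerC; split=> // i; rewrite coefC.
  by case: eqP => _; [exact: rgen_const | exact: rgen0].
- exists x%:P; rewrite hornerC; split=> // i; rewrite coefC.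
  by case: eqP => _; [exact: rgen_mem | exact: rgen0].
- exists 'X; rewrite hornerX; split=> // i; rewrite coefX.
  by case: eqP => _; [exact: rgen1 | exact: rgen0].
- exists (q1 + q2); rewrite hornerD; split=> // i.
  by rewrite coefD; exact: rgen_add.
- exists (q1 * q2); rewrite hornerM; split=> // i.
  by rewrite coefM; apply: rgen_sum => *; exact: rgen_mul.
Qed.

(** An equation of [z] over [k[S][y]] is reordered as a polynomial [r] in [y] with coefficients in
    [k[S][z]]. Were [r] zero, its coefficients would be equations of [z] over [k[S]], one of them
    nontrivial. *)
Lemma acl_exchange S y z :
  acl (adjoin S y) z -> ~ acl S z -> acl (adjoin S z) y.
Proof.
move=> [q [q0 Sq qz]] nSz.
have [A AE] := choice (fun i => rgen_adjoin (Sq i)).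
pose r := \sum_(j < size q) z ^+ j *: A j.
have rE i : r`_i = (\poly_(j < size q) (A j)`_i).[z].
  rewrite coef_sum horner_poly; apply: eq_bigr => j _.
  by rewrite coefZ mulrC.
exists r; split.
(* The leading coefficient of [q] is [(A d).[y]], so [A d] is nonzero, with leading coefficient at
   [i]; this makes the equation of [z] read off at degree [i] in [y] nontrivial. *)
- apply/eqP=> r0; apply: nSz.
  pose d := (size q).-1.
  have /eqP Ad0 : A d != 0.
    apply: contraNneq q0 => Ad0; rewrite -lead_coef_eq0 lead_coefE.
    by have [_ ->] := AE (size q).-1; rewrite -/d Ad0 horner0.
  pose i := (size (A d)).-1.
  exists (\poly_(j < size q) (A j)`_i); split.
  + apply/eqP=> /polyP /(_ d); rewrite coef_poly coef0 /d prednK ?size_poly_gt0 //.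
    by rewrite leqnn -lead_coefE => /eqP; rewrite lead_coef_eq0 => /eqP.
  + move=> j; rewrite coef_poly; case: ifP => _; last exact: rgen0.
    by have [] := AE j.
  + by apply/rootP; rewrite -rE r0 coef0.
- move=> i; rewrite coef_sum; apply: rgen_sum => j _; rewrite coefZ.
  apply: rgen_mul; first by apply/rgen_exp/rgen_mem; right.
  have [Sj _] := AE j.
  by apply: rgen_sub (Sj i) => x Sx; apply: rgen_mem; left.
- apply/rootP; rewrite horner_sum -[RHS](rootP qz) horner_coef.
  apply: eq_bigr => j _; rewrite hornerZ mulrC.
  by have [_ ->] := AE j.
Qed.

(** Members of [Y] are moved into [S] until [z] becomes algebraic; the member that causes this is
    exchanged for [z]. *)
Lemma steinitz_exchange S (Y : seq K) z :
  acl (fun x => S x \/ x \in Y) z -> ~ acl S z ->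
  exists Y', (size Y').+1 = size Y /\
    forall x, S x \/ x \in Y -> acl (fun x => adjoin S z x \/ x \in Y') x.
Proof.
elim: Y S => [|y Y IHY] S Sz nSz.
  by case: nSz; apply: acl_subset Sz => x [].
have [Syz|nSyz] := EM (acl (adjoin S y) z).
  exists Y; split=> // x [Sx|]; first by apply: acl_mem; do 2 left.
  rewrite inE => /orP[/eqP->|Yx]; last by apply: acl_mem; right.
  by apply: acl_subset (acl_exchange Syz nSz) => t; left.
have [|Y' [sY' hY']] := IHY (adjoin S y) _ nSyz.
  apply: acl_subset Sz => x [Sx|]; first by do 2 left.
  by rewrite inE => /orP[/eqP->|Yx]; [left; right | right].
exists (y :: Y'); split; first by rewrite /= sY'.
move=> x Sx; have /hY' : adjoin S y x \/ x \in Y.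
  case: Sx => [Sx|]; first by do 2 left.
  by rewrite inE => /orP[/eqP->|Yx]; [left; right | right].
apply: acl_subset => t [[[St|->]|->]|Yt].
- by do 2 left.
- by right; rewrite mem_head.
- by left; right.
- by right; rewrite inE Yt orbT.
Qed.

(** Algebraic independence in its ordered form, each member transcendental over its predecessors, as
    a chain of primes provides it. *)
Definition alg_indep n (f : nat -> K) :=
  forall i, (i < n)%N -> ~ acl (fun x => exists2 l, (l < i)%N & x = f l) (f i).

Lemma alg_indep_leq n (f : nat -> K) (Y : seq K) :
  alg_indep n f -> (forall i, (i < n)%N -> acl (fun x => x \in Y) (f i)) ->
  (n <= size Y)%N.
Proof.
move=> fI fY.
(* After [m] exchanges the first [m] members of [f] stand in for [m] elements of [Y]. *)
suff: forall m, (m <= n)%N -> exists Y', (size Y' + m)%N = size Y /\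
    forall i, (i < n)%N ->
      acl (fun x => (exists2 l, (l < m)%N & x = f l) \/ x \in Y') (f i).
  by move=> /(_ n (leqnn n))[Y' [<- _]]; exact: leq_addl.
elim=> [|m IHm] lemn.
  exists Y; rewrite addn0; split=> // i /fY.
  by apply: acl_subset => x; right.
have [Y1 [s1 h1]] := IHm (ltnW lemn).
have [Y2 [s2 h2]] := steinitz_exchange (h1 m lemn) (fI m lemn).
exists Y2; rewrite addnS -addSn s2 s1; split=> // i /h1.
apply: acl_trans => x /h2; apply: acl_subset => t [[[l lt ->]|->]|]; last by right.
- by left; exists l; rewrite // ltnS ltnW.
- by left; exists m.
Qed.

End AlgebraicClosure.

(** * Generic points and projections *)

(* [Q] is a Sylvester determinant, built from formal degrees so that its image
   under [th] is triangular. *)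
Lemma elimination (A : comNzRingType) (k K : fieldType)
    (th : {rmorphism A -> k}) (ev : {rmorphism A -> K}) (p q : {poly A})
    (t : K) (c : k) (d : nat) :
  c != 0 -> map_poly th p = c%:P -> (size q <= d.+1)%N -> th q`_d != 0 ->
  root (map_poly ev p) t -> root (map_poly ev q) t ->
  exists Q : A, ev Q = 0 /\ th Q != 0.
Proof.
move=> c0 thp sq thq pt qt; pose e := size p.
have e_gt0 : (0 < e)%N.
  rewrite size_poly_gt0; apply: contra_neq c0 => p0.
  by apply/eqP; rewrite -polyC_eq0 -thp p0 rmorph0.
(* Rows: [d] shifts of [p], then [e] shifts of [q]. Under [ev] all of them vanish at [t], so the
   powers of [t] form a kernel vector. *)
pose r (i : nat) : {poly A} := if (i < d)%N then p * 'X^i else q * 'X^(i - d).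
have sr (i : 'I_(d + e)) : (size (r i) <= d + e)%N.
  rewrite /r; case: ltnP => [lt|le]; apply: leq_trans (size_polyMleq _ _) _;
    rewrite size_polyXn addnS /=.
    by rewrite addnC leq_add // ltnW.
  apply: leq_trans (_ : d.+1 + (i - d) <= _)%N; first by rewrite leq_add2r.
  by rewrite addSn subnKC.
pose M : 'M[A]_(d + e) := \matrix_(i, j) (r i)`_j.
exists (\det M); split.
  rewrite -det_map_mx -det_tr; apply/eqP/det0P.
  exists (\row_j t ^+ j).
    have lt0 : (0 < d + e)%N by rewrite addn_gt0 e_gt0 orbT.
    apply/eqP => /rowP /(_ (Ordinal lt0)); rewrite !mxE expr0.
    exact/eqP/oner_neq0.
  apply/rowP => i; rewrite !mxE.
  transitivity (map_poly ev (r i)).[t].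
    rewrite (horner_coef_wide _ (leq_trans (size_poly _ _) (sr i))).
    by apply: eq_bigr => j _; rewrite !mxE coef_map mulrC.
  rewrite /r; case: ifP => _; rewrite rmorphM hornerM /=.
    by rewrite (rootP pt) mul0r.
  by rewrite (rootP qt) mul0r.
(* Under [th] the rows of [p] become [c] times a basis vector, and those of [q] end on the diagonal
   with the coefficient of degree [d]. *)
rewrite -det_map_mx det_trig; last first.
  apply/is_trig_mxP => i j lt; rewrite !mxE /r; case: ltnP => [_|le].
    by rewrite -coef_map rmorphM /= map_polyXn thp /= coefCM coefXn gtn_eqF ?mulr0.
  rewrite nth_default ?rmorph0 //; apply: leq_trans (size_polyMleq _ _) _.
  rewrite size_polyXn addnS /=; apply: leq_trans lt; rewrite -[i.+1](subnKC (leqW le)).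
  by rewrite subSn // addnS -addSn leq_add2r.
rewrite prodf_seq_neq0; apply/allP => i _; apply/implyP => _; rewrite !mxE /r.
case: ltnP => [_|le].
  by rewrite -coef_map rmorphM /= map_polyXn thp /= coefCM coefXn eqxx mulr1.
by rewrite coefMXn ltnNge leq_subr subKn.
Qed.

Section GenericPoint.
Variables (k : closedFieldType) (K : fieldType) (iota : {rmorphism k -> K}).

Local Notation gev := (mmap iota).
Local Notation cl xi := (acl iota (fun y => exists i, y = xi i)).

(** The [k]-points of the affine variety whose generic point is [xi]. *)
Definition specializes n (xi : 'I_n -> K) (x : 'rV[k]_n) :=
  forall f, gev xi f = 0 -> f.@[x 0] = 0.

Definition mcomp n r (W : 'I_r -> {mpoly k[n]}) : {mpoly k[r]} -> {mpoly k[n]} :=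
  mmap (@mpolyC n k) W.

Lemma gev_mcomp n r (xi : 'I_n -> K) (W : 'I_r -> {mpoly k[n]}) H :
  gev xi (mcomp W H) = gev (fun j => gev xi (W j)) H.
Proof. by rewrite rmorph_mmap; apply: eq_mmap => // c /=; rewrite mmapC. Qed.

Lemma meval_mcomp n r (x : 'I_n -> k) (W : 'I_r -> {mpoly k[n]}) H :
  (mcomp W H).@[x] = H.@[fun j => (W j).@[x]].
Proof. by rewrite rmorph_mmap; apply: eq_mmap => // c /=; rewrite mevalC. Qed.

Lemma rgen_gev n (xi : 'I_n -> K) y :
  rgen iota (fun y => exists i, y = xi i) y -> exists h, y = gev xi h.
Proof.
elim=> [c|_ [i ->]|_ _ _ [h1 ->] _ [h2 ->]|_ _ _ [h1 ->] _ [h2 ->]].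
- by exists c%:MP; rewrite mmapC.
- by exists 'X_i; rewrite mmapXU.
- by exists (h1 + h2); rewrite rmorphD.
- by exists (h1 * h2); rewrite rmorphM.
Qed.

Lemma gev_rgen n (xi : 'I_n -> K) (S : K -> Prop) h :
  (forall i, rgen iota S (xi i)) -> rgen iota S (gev xi h).
Proof.
move=> Sxi; elim/mpoly_ring_ind: h => [c|i|p q|p q]; rewrite ?mmapC ?mmapXU //.
- exact: rgen_const.
- by rewrite rmorphD; exact: rgen_add.
- by rewrite rmorphM; exact: rgen_mul.
Qed.

Lemma cl_gev n (xi : 'I_n -> K) (S : K -> Prop) h :
  (forall i, acl iota S (xi i)) -> acl iota S (gev xi h).
Proof.
move=> Sxi; elim/mpoly_ring_ind: h => [c|i|p q|p q]; rewrite ?mmapC ?mmapXU //.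
- exact: acl_const.
- by rewrite rmorphD; exact: acl_add.
- by rewrite rmorphM; exact: acl_mul.
Qed.

(** Since [z] is nonzero, factors ['X] of its equation can be cancelled. *)
Lemma acl_coef0 (S : K -> Prop) z : z != 0 -> acl iota S z ->
  exists q : {poly K}, [/\ q`_0 != 0, rgen_poly iota S q & root q z].
Proof.
move=> z0 [q []]; elim/poly_ind: q => [|p c IHp]; first by rewrite eqxx.
have [->|c0] := eqVneq c 0; last first.
  move=> _ Sq qz; exists (p * 'X + c%:P); split=> //.
  by rewrite coefD coefMX coefC add0r.
rewrite polyC0 addr0 => pX Sp; rewrite rootM rootX (negbTE z0) orbF => pz.
apply: IHp => // [|i]; first by apply: contra_neq pX => ->; rewrite mul0r.
by have := Sp i.+1; rewrite coefMX.
Qed.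

(* The constant coefficient of an algebraic equation of [g] over [k[w]]. *)
Lemma algebraic_denominator n r (xi : 'I_n -> K) (W : 'I_r -> {mpoly k[n]}) g :
  (forall i, cl (fun j => gev xi (W j)) (xi i)) -> gev xi g != 0 ->
  exists G, gev (fun j => gev xi (W j)) G != 0 /\
    forall x : 'rV_n, specializes xi x -> G.@[fun j => (W j).@[x 0]] != 0 -> g.@[x 0] != 0.
Proof.
move=> Wxi gxi; have [q [q0 Sq qz]] := acl_coef0 gxi (cl_gev g Wxi).
have [H HE] := choice (fun i => rgen_gev (Sq i)).
exists (H 0%N); rewrite -HE; split=> // x xix; apply: contra_neq => gx.
(* The equation of [g], lifted to a polynomial vanishing at [xi]. Where [g] vanishes, only the
   constant term survives in it, and must vanish too. *)
pose F := \sum_(i < size q) mcomp W (H i) * g ^+ i.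
have : gev xi F = 0.
  rewrite -(rootP qz) horner_coef rmorph_sum; apply: eq_bigr => i _.
  by rewrite rmorphM rmorphXn /= gev_mcomp -HE.
move/xix; rewrite rmorph_sum.
have q_gt0 : (0 < size q)%N.
  by rewrite lt0n size_poly_eq0; apply: contraNneq q0 => ->; rewrite coef0.
rewrite (bigD1 (Ordinal q_gt0)) //= big1 ?addr0; last first.
  move=> i nei; rewrite rmorphM rmorphXn /= gx expr0n.
  by move: nei; rewrite -val_eqE /= => /negbTE ->; rewrite mulr0.
by rewrite rmorphM rmorphXn /= expr0 mulr1 meval_mcomp.
Qed.

(** * Linear projection from a point, and lifting through it *)

Section Projection.
Variables (m : nat) (i1 : 'I_m.+1) (b : 'I_m.+1 -> k).
Hypothesis b1 : b i1 = 1.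

(** Places the target of the projection as the hyperplane [x_i1 = 0]; a point is then its image plus
    a multiple of the center [b]. *)
Definition ext0 (S : nmodType) (v : 'I_m -> S) (i : 'I_m.+1) : S :=
  oapp v 0 (unlift i1 i).

(** The linear projection from [b] in coordinates: these forms vanish at [b], which is normalized by
    [b i1 = 1]. *)
Definition proj_form (j : 'I_m) : {mpoly k[m.+1]} :=
  'X_(lift i1 j) - (b (lift i1 j))%:MP * 'X_i1.

Lemma gev_proj_form (xi : 'I_m.+1 -> K) j :
  gev xi (proj_form j) = xi (lift i1 j) - iota (b (lift i1 j)) * xi i1.
Proof. by rewrite rmorphB rmorphM /= !mmapXU mmapC. Qed.

Lemma meval_proj_form (x : 'I_m.+1 -> k) j :
  (proj_form j).@[x] = x (lift i1 j) - b (lift i1 j) * x i1.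
Proof. by rewrite mevalB mevalM !mevalXU mevalC. Qed.

Lemma gev_proj_rec (xi : 'I_m.+1 -> K) i :
  xi i = ext0 (fun j => gev xi (proj_form j)) i + iota (b i) * xi i1.
Proof.
rewrite /ext0; case: unliftP => [j ->|->] /=; last by rewrite b1 rmorph1 mul1r add0r.
by rewrite gev_proj_form subrK.
Qed.

Lemma meval_proj_rec (x : 'I_m.+1 -> k) i :
  x i = ext0 (fun j => (proj_form j).@[x]) i + b i * x i1.
Proof.
rewrite /ext0; case: unliftP => [j ->|->] /=; last by rewrite b1 mul1r add0r.
by rewrite meval_proj_form subrK.
Qed.

Lemma rmorph_ext0 (S T : nmodType) (psi : {additive S -> T}) (v : 'I_m -> S) i :
  psi (ext0 v i) = ext0 (psi \o v) i.
Proof. by rewrite /ext0; case: unlift => //=; rewrite raddf0. Qed.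

Lemma eq_ext0 (S : nmodType) (v v' : 'I_m -> S) : v =1 v' -> ext0 v =1 ext0 v'.
Proof. by move=> e i; rewrite /ext0; case: unlift => //=. Qed.

(* Extension of specializations along [k[w] -> k[w][s]], [s] algebraic over
   [k[w]]: away from the leading coefficient of a minimal equation [q] of [s],
   any root of the specialized [q] will do. *)
Lemma lift_spec (xi : 'I_m.+1 -> K) :
  cl (fun j => gev xi (proj_form j)) (xi i1) ->
  exists l, gev (fun j => gev xi (proj_form j)) l != 0 /\
    forall x1, specializes (fun j => gev xi (proj_form j)) x1 -> l.@[x1 0] != 0 ->
    exists x, specializes xi x /\ forall j, (proj_form j).@[x 0] = x1 0 j.
Proof.
set w := (fun j : 'I_m => mmap iota xi (proj_form j)); set s := xi i1 => ws.
pose ev : {rmorphism {mpoly k[m]} -> K} := mmap iota w.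
(* Sizes of the equations of [s] with coefficients lifted to [{mpoly k[m]}]; one of least size
   serves as [q]. *)
pose D d := exists q : {poly {mpoly k[m]}},
  [/\ size q = d, ev (lead_coef q) != 0 & root (map_poly ev q) s].
have truncD (h : nat -> {mpoly k[m]}) (q : {poly K}) :
    q != 0 -> (forall i, q`_i = ev (h i)) -> root q s -> D (size q).
  move=> q0 hq qs; pose q' := \poly_(i < size q) h i.
  have q_gt0 : (0 < size q)%N by rewrite size_poly_gt0.
  have hl : ev (h (size q).-1) != 0 by rewrite -hq -lead_coefE lead_coef_eq0.
  have hl0 : h (size q).-1 != 0.
    by apply: contraNneq hl => ->; rewrite rmorph0.
  have sq' : size q' = size q by rewrite size_poly_eq.
  exists q'; split=> //; first by rewrite lead_coefE sq' coef_poly prednK ?leqnn.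
  suff -> : map_poly ev q' = q by [].
  apply/polyP => i; rewrite coef_map coef_poly; case: ltnP => [_|le] //.
  by rewrite nth_default //; exact: rmorph0.
have exD : exists d, `[< D d >].
  have [q [q0 Sq qs]] := ws.
  have [H HE] := choice (fun i => rgen_gev (Sq i)).
  by exists (size q); apply/asboolP; exact: (truncD H).
case: (ex_minnP exD) => d /asboolP[q [sq lq qs]] dmin.
(* Pseudo-division by [q]: by minimality all coefficients of the remainder vanish at [w]. *)
have remP p : root (map_poly ev p) s -> exists e h r,
    lead_coef q ^+ e *: p = h * q + r /\ forall i, ev r`_i = 0.
  move=> ps; exists (scalp p q), (p %/ q)%R, (p %% q)%R.
  have e := Pdiv.Idomain.divp_eq p q.
  split=> //; set r := (p %% q)%R in e *.
  have rs : root (map_poly ev r) s.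
    have : map_poly ev (lead_coef q ^+ scalp p q *: p) = map_poly ev ((p %/ q) * q + r).
      by rewrite e.
    rewrite map_polyZ rmorphD rmorphM /= => /(congr1 (horner^~ s)).
    rewrite hornerZ hornerD hornerM (rootP ps) (rootP qs) !mulr0 add0r => /esym e'.
    exact/rootP.
  have [/polyP r0 i|nzr] := eqVneq (map_poly ev r) 0.
    by have := r0 i; rewrite coef_map coef0.
  have /asboolP/dmin : D (size (map_poly ev r)).
    by apply: (truncD (fun i => r`_i)) => // i; rewrite coef_map.
  rewrite -sq leqNgt => /negP[].
  apply: leq_ltn_trans (size_poly _ _) _; apply: ltn_modpN0.
  by rewrite -lead_coef_eq0; apply: contraNneq lq => ->; rewrite rmorph0.
exists (lead_coef q); split=> // x1 wx1 lx1.
pose q1 := map_poly (meval (x1 0)) q.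
have sq1 : size q1 = size q by rewrite size_map_poly_id0.
have : size q1 != 1%N.
  have eqs : size (map_poly ev q) = size q by rewrite size_map_poly_id0.
  rewrite sq1 -eqs neq_ltn (root_size_gt1 _ qs) ?orbT //.
  rewrite -size_poly_gt0 eqs size_poly_gt0 -lead_coef_eq0.
  by apply: contraNneq lq => ->; rewrite rmorph0.
case/closed_rootP => s0 /rootP q1s0.
exists (\row_i (ext0 (x1 0) i + b i * s0)); split=> [f fxi|j]; last first.
  rewrite meval_proj_form !mxE /ext0 liftK unlift_none /= add0r b1 mul1r.
  by rewrite addrK.
(* [f] as a polynomial in coordinate [i1] over the coordinates of the projection. It has the root
   [s] at the generic point, so [remP] applies, and the remainder dies at [x1]. *)
pose p := line_subst (@mpolyC m k) (ext0 (fun j => 'X_j)) (fun i => (b i)%:MP) f.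
have ps : root (map_poly ev p) s.
  apply/rootP; rewrite map_line_subst horner_line_subst -[RHS]fxi; apply: eq_mmap => [c|i] /=.
    by rewrite mmapC.
  rewrite rmorph_ext0 mmapC [RHS]gev_proj_rec; congr (_ + _).
  by apply: eq_ext0 => j /=; rewrite mmapXU.
have -> : f.@[(\row_i (ext0 (x1 0) i + b i * s0)) 0] = (map_poly (meval (x1 0)) p).[s0].
  rewrite map_line_subst horner_line_subst; apply: eq_mmap => [c|i] /=.
    by rewrite mevalC.
  rewrite mxE rmorph_ext0 mevalC; congr (_ + _).
  by apply: eq_ext0 => j /=; rewrite mevalXU.
have [e [h [r [pE r0]]]] := remP p ps.
have := congr1 (fun u => (map_poly (meval (x1 0)) u).[s0]) pE.
rewrite /= map_polyZ rmorphD rmorphM /= hornerZ hornerD hornerM q1s0 mulr0 add0r.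
have -> : map_poly (meval (x1 0)) r = 0.
  by apply/polyP => i; rewrite coef_map coef0; exact/wx1/r0.
rewrite horner0 rmorphXn => /eqP; rewrite mulf_eq0 expf_eq0 (negbTE lx1) andbF /=.
by move/eqP.
Qed.

End Projection.
End GenericPoint.

(** In characteristic 0 the naturals provide more distinct roots than the degree allows. *)
Lemma poly_nat_roots (F : fieldType) (p : {poly F}) :
  [pchar F] =i pred0 -> (forall n : nat, p.[n%:R] = 0) -> p = 0.
Proof.
move=> /pcharf0P ch0 p0; apply/eqP/negPn/negP => nzp.
pose rs : seq F := [seq i%:R | i <- iota 0 (size p)].
have rsp : all (root p) rs by apply/allP => _ /mapP[i _ ->]; exact/rootP.
have urs : uniq rs.
  rewrite map_inj_uniq ?iota_uniq // => i j.
  wlog leij : i j / (i <= j)%N.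
    by move=> IH e; have /orP[/IH->|/IH->] := leq_total i j.
  move=> e; apply/eqP; rewrite eqn_leq leij -subn_eq0 -ch0 natrB // e.
  by rewrite subrr eqxx.
by have := max_poly_roots nzp rsp urs; rewrite size_map size_iota ltnn.
Qed.

Lemma poly_drop1 (R : nzRingType) (p : {poly R}) :
  p`_0 = 0 -> exists2 q : {poly R}, p = q * 'X & forall i, q`_i = p`_i.+1.
Proof.
move=> p0; have qE i : (\poly_(i < size p) p`_i.+1)`_i = p`_i.+1.
  by rewrite coef_poly; case: ltnP => // le; rewrite nth_default // ltnW.
exists (\poly_(i < size p) p`_i.+1) => //.
by apply/polyP => -[|i]; rewrite coefMX.
Qed.

Lemma coef1_exp (R : comNzRingType) d : (('X + 1 : {poly R}) ^+ d)`_1 = d%:R.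
Proof.
have c0 e : (('X + 1 : {poly R}) ^+ e)`_0 = 1.
  by rewrite -horner_coef0 hornerE /= !hornerE expr1n.
elim: d => [|d IHd]; first by rewrite expr0 coef1.
by rewrite exprS mulrDl mul1r coefD coefXM /= c0 IHd -natr1 addrC.
Qed.

(** * Spanning a point by general points of the variety *)

Section Spanning.
Variables (k : closedFieldType) (K : fieldType) (iota : {rmorphism k -> K}).
Hypothesis pchark : [pchar k] =i pred0.

Local Notation gev := (mmap iota).
Local Notation cl xi := (acl iota (fun y => exists i, y = xi i)).

(* [xi] is a generic point of the affine cone, over the origin, of a nondegenerate
   projective variety, whose [k]-points are the [x] with [specializes iota xi x]. *)
Record generic n (xi : 'I_n -> K) : Prop := Generic {
  generic_free : forall c : 'I_n -> k,
    \sum_i iota (c i) * xi i = 0 -> forall i, c i = 0;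
  generic_cone : forall f t, gev xi f = 0 -> gev (fun i => t * xi i) f = 0;
  generic_dense : forall h, gev xi h != 0 ->
    exists x : 'rV_n, specializes iota xi x /\ h.@[x 0] != 0 }.

Lemma generic_neq0 n (xi : 'I_n -> K) i : generic xi -> xi i != 0.
Proof.
move=> gxi; apply/eqP => x0.
have := generic_free gxi (c := fun l => (l == i)%:R).
suff -> : \sum_l iota (l == i)%:R * xi l = 0.
  by move=> /(_ erefl i) /eqP; rewrite eqxx oner_eq0.
apply: big1 => l _; case: eqP => [->|_]; first by rewrite x0 mulr0.
by rewrite rmorph0 mul0r.
Qed.

(** The point to be spanned, in adapted coordinates. *)
Definition e0 n (i : 'I_n.+1) : k := (i == ord0)%:R.

(** Along [t * xi] the values of [Q] form a polynomial in [t] whose coefficients are the values of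
    the homogeneous components; it vanishes at all naturals. *)
Lemma gev_pihomog n (xi : 'I_n -> K) Q :
  (forall t : nat, gev (fun i => t%:R * xi i) Q = 0) ->
  forall d, gev xi (pihomog mdeg d Q) = 0.
Proof.
move=> xiQ d.
have QE D := @pihomog_partitionE n k mdeg (maxn D (mmeasure mdeg Q)) Q (leq_maxr _ _).
set D := maxn d.+1 (mmeasure mdeg Q).
pose R := \poly_(d < D) gev xi (pihomog mdeg d Q).
have R0 : R = 0.
  apply: poly_nat_roots => [|t]; first by move=> p; rewrite (fmorph_pchar iota).
  rewrite horner_poly -[RHS](xiQ t) [in RHS](QE d.+1) rmorph_sum.
  apply: eq_bigr => i _ /=; rewrite (homog_mmap _ _ _ (pihomogP mdeg i Q)).
  by rewrite mulrC.
by have /polyP/(_ d) := R0; rewrite coef_poly coef0 leq_max leqnn.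
Qed.

Lemma e0_sum n (c : 'I_n.+1 -> k) : \sum_i c i * e0 i = c ord0.
Proof.
rewrite (bigD1 ord0) //= /e0 eqxx mulr1 big1 ?addr0 // => i /negbTE ->.
by rewrite mulr0.
Qed.

Lemma homog_component n (xi : 'I_n.+1 -> K) Q :
  generic xi -> gev xi Q = 0 -> Q.@[@e0 n] != 0 ->
  exists d P, [/\ P \is d.-homog, gev xi P = 0 & P.@[@e0 n] != 0].
Proof.
move=> gxi xiQ Qe.
have QE := @pihomog_partitionE n.+1 k mdeg (mmeasure mdeg Q) Q (leqnn _).
have [d Pd] : exists d : 'I_(mmeasure mdeg Q), (pihomog mdeg d Q).@[@e0 n] != 0.
  apply/existsP; apply: contraNT Qe; rewrite negb_exists => /forallP h.
  rewrite QE rmorph_sum big1 //= => d _; have := h d; rewrite negbK.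
  by move/eqP.
exists d, (pihomog mdeg d Q); split=> //; first exact: pihomogP.
by apply: gev_pihomog => t; exact: generic_cone.
Qed.

Lemma rgen_line_subst n (S : K -> Prop) (a w : 'I_n -> K) (f : {mpoly k[n]}) :
  (forall i, rgen iota S (a i)) -> (forall i, rgen iota S (w i)) ->
  rgen_poly iota S (line_subst iota a w f).
Proof.
move=> Sa Sw; elim/mpoly_ring_ind: f => [c|i|p q Sp Sq|p q Sp Sq] l.
- by rewrite line_substC coefC; case: eqP => _; [exact: rgen_const | exact: rgen0].
- rewrite line_substX coefD coefC coefZ coefX; apply: rgen_add.
    by case: eqP => _ //; exact: rgen0.
  apply: rgen_mul => //.
  by case: eqP => _; [exact: rgen1 | exact: rgen0].
- by rewrite rmorphD coefD; exact: rgen_add.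
- by rewrite rmorphM coefM; apply: rgen_sum => *; exact: rgen_mul.
Qed.

Lemma gev_const n (a : 'I_n -> k) f : gev (iota \o a) f = iota f.@[a].
Proof. by rewrite /meval rmorph_mmap. Qed.

(** Projection from a point off the variety is finite: a form [P] vanishing at [xi] but not at [e0]
    is an equation in coordinate 0 whose leading coefficient is the nonzero constant [P(e0)]. *)
Lemma algebraic_over_projection n (xi : 'I_n.+1 -> K) Q :
  generic xi -> gev xi Q = 0 -> Q.@[@e0 n] != 0 ->
  forall i, cl (fun j => xi (lift ord0 j)) (xi i).
Proof.
move=> gxi xiQ Qe i; case: (unliftP ord0 i) => [j ->|->].
  by apply: acl_mem; exists j.
have [d [P [hP xiP Pe]]] := homog_component gxi xiQ Qe.
(* The generic point with coordinate 0 cleared; the line from it in direction [e0] reaches [xi] at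
   parameter [xi ord0]. *)
pose a := ext0 (ord0 : 'I_n.+1) (fun j => xi (lift ord0 j)).
exists (line_subst iota a (iota \o @e0 n) P); split.
- apply: contra_neq Pe => q0; apply: (fmorph_inj iota).
  rewrite -gev_const rmorph0.
  by have [_ <-] := line_subst_top iota a (iota \o @e0 n) hP; rewrite q0 coef0.
- apply: rgen_line_subst => l /=; last exact: rgen_const.
  rewrite /a /ext0; case: unlift => [j|] /=; last exact: rgen0.
  by apply: rgen_mem; exists j.
- apply/rootP; rewrite horner_line_subst -[RHS]xiP; apply: eq_mmap => // l /=.
  rewrite /a /ext0 /e0; case: unliftP => [j ->|->] /=.
    by rewrite mulr0n rmorph0 mul0r addr0.
  by rewrite ?eqxx mulr1n rmorph1 mul1r add0r.
Qed.

Lemma leq_dim n (xi : 'I_n -> K) N0 (f : nat -> K) :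
  alg_indep iota N0 f -> (forall i, (i < N0)%N -> cl xi (f i)) -> (N0 <= n)%N.
Proof.
move=> fI xif; rewrite -[n]card_ord -(size_codom xi).
apply: (alg_indep_leq fI) => i /xif; apply: acl_subset => _ [l ->].
exact: codom_f.
Qed.

(** [P] is taken of least degree among the forms vanishing at [xi] but not at [e0]. By Euler's
    identity its derivative is nonzero at [e0] in characteristic 0; vanishing at [xi], it would be
    such a form of smaller degree. *)
Lemma nonvanishing_derivative n (xi : 'I_n.+1 -> K) Q :
  generic xi -> gev xi Q = 0 -> Q.@[@e0 n] != 0 ->
  exists d P, [/\ P \is d.-homog, gev xi P = 0, P.@[@e0 n] != 0 &
    gev xi P^`M(ord0) != 0].
Proof.
move=> gxi xiQ Qe.
have exd : exists d, `[< exists P : {mpoly k[n.+1]},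
    [/\ P \is d.-homog, gev xi P = 0 & P.@[@e0 n] != 0] >].
  have [d [P hP]] := homog_component gxi xiQ Qe.
  by exists d; apply/asboolP; exists P.
case: (ex_minnP exd) => d /asboolP[P [hP xiP Pe]] dmin.
exists d, P; split=> //; apply/eqP => xidP.
(* Euler's identity at [e0], from the linear term of [P((1 + t) e0) = (1 + t)^d P(e0)]. *)
have dP : (P^`M(ord0)).@[@e0 n] = P.@[@e0 n] *+ d.
  rewrite -[LHS](e0_sum (fun i => (P^`M(i)).@[@e0 n])).
  have := line_subst_coef1 (idfun : {rmorphism k -> k}) (@e0 n) (@e0 n) P.
  have -> : line_subst (idfun : {rmorphism k -> k}) (idfun \o @e0 n) (@e0 n) P =
      ('X + 1) ^+ d * (P.@[@e0 n])%:P.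
    rewrite -[in RHS]/(polyC _) rmorph_mmap -(homog_mmap _ _ _ hP).
    apply: eq_mmap => // i /=.
    by rewrite mulrDl mul1r addrC mulrC mul_polyC.
  by move=> <-; rewrite coefMC coef1_exp mulr_natl.
(* In degree 0, [P] takes the same value at [e0] and at [xi], which is absurd. *)
case: d => [|d] in hP dmin dP *.
  have zero (h : 'I_n.+1 -> k) : P.@[fun i => 0 * h i] = P.@[h].
    by rewrite /meval (homog_mmap _ _ _ hP) expr0 mul1r.
  case/eqP: Pe; apply: (fmorph_inj iota); rewrite -zero -gev_const rmorph0 -[RHS]xiP.
  rewrite -[RHS]mul1r -(expr0 0) -(homog_mmap _ _ _ hP).
  by apply: eq_mmap => // i /=; rewrite !mul0r rmorph0.
suff /asboolP/dmin : exists P : {mpoly k[n.+1]},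
    [/\ P \is d.-homog, gev xi P = 0 & P.@[@e0 n] != 0] by rewrite ltnn.
exists P^`M(ord0); split=> //; last first.
  have /pcharf0P ch0 := pchark.
  by rewrite dP -mulr_natl mulf_neq0 // ch0.
apply/dhomogP => m; rewrite mcoeff_msupp mcoeff_mderiv => dPm.
have : (m + U_(ord0))%MM \in msupp P.
  by rewrite mcoeff_msupp; apply: contraNneq dPm => ->; rewrite mul0rn.
by move/dhomogP: hP => hP /hP /=; rewrite mdegD mdeg1 addn1 => -[].
Qed.

(** * Restriction to a line in direction [e0] *)

Definition line_restr n (a : 'I_n.+1 -> k) : {mpoly k[n.+1]} -> {poly k} :=
  line_subst (idfun : {rmorphism k -> k}) a (@e0 n).

HB.instance Definition _ n (a : 'I_n.+1 -> k) := GRing.RMorphism.copy (line_restr a)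
  (line_subst (idfun : {rmorphism k -> k}) a (@e0 n)).

(** The polynomial [x_0 - a_0] restricts to the parameter. Surjectivity makes the restrictions of an
    ideal an ideal. *)
Lemma line_restr_surj n (a : 'I_n.+1 -> k) u : exists h, line_restr a h = u.
Proof.
exists (map_poly (@mpolyC n.+1 k) u).['X_ord0 - (a ord0)%:MP].
rewrite -horner_map -map_poly_comp rmorphB /= {2 3}/line_restr line_substX line_substC.
rewrite /e0 eqxx scale1r addrAC subrr add0r -[RHS]comp_polyXr /comp_poly.
by congr _.['X]; apply: eq_map_poly => c /=; rewrite /line_restr line_substC.
Qed.

Lemma line_restr_coef0 n (a : 'I_n.+1 -> k) f : (line_restr a f)`_0 = f.@[a].
Proof. exact: line_subst_coef0. Qed.

Lemma line_restr_coef1 n (a : 'I_n.+1 -> k) f :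
  (line_restr a f)`_1 = (f^`M(ord0)).@[a].
Proof.
rewrite -[RHS](e0_sum (fun i => f^`M(i).@[a])).
exact: (line_subst_coef1 (idfun : {rmorphism k -> k}) a (@e0 n) f).
Qed.

Lemma horner_line_restr n (a : 'I_n.+1 -> k) f t :
  (line_restr a f).[t] = f.@[fun i => a i + e0 i * t].
Proof. exact: horner_line_subst. Qed.

(* The restrictions to the line [a + t e0] of the polynomials vanishing at [xi]
   form an ideal of [k[t]]; its generator has a simple root at [0]. *)
Lemma line_dichotomy n (xi : 'I_n.+1 -> K) (a : 'rV[k]_n.+1) P :
  specializes iota xi a -> gev xi P = 0 -> (P^`M(ord0)).@[a 0] != 0 ->
  (exists2 r, r != 0 & specializes iota xi (\row_i (a 0 i + e0 i * r))) \/
  exists f c, [/\ gev xi f = 0, c != 0 & line_restr (a 0) f = c%:P * 'X].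
Proof.
move=> xia xiP dPa; set L := line_restr (a 0).
have L0 f : gev xi f = 0 -> (L f)`_0 = 0 by move/xia; rewrite line_restr_coef0.
have exd : exists d, `[< exists f, [/\ gev xi f = 0, L f != 0 & size (L f) = d] >].
  exists (size (L P)); apply/asboolP; exists P; split=> //.
  by apply: contraNneq dPa => LP0; rewrite -line_restr_coef1 -/L LP0 coef0.
case: (ex_minnP exd) => d /asboolP[f [xif nzf sf]] dmin.
(* The restriction of [f] has least size; division stays within the ideal, as the quotient lifts to
   a polynomial [u]. *)
have Lf_dvd h : gev xi h = 0 -> exists u, L h = u * L f.
  move=> xih; have [u uE] := line_restr_surj (a 0) (L h %/ L f)%R.
  exists (L h %/ L f)%R; rewrite [LHS](divp_eq _ (L f)).
  suff -> : (L h %% L f)%R = 0 by rewrite addr0.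
  have rE : (L h %% L f)%R = L (h - u * f).
    rewrite [in RHS]/L rmorphB rmorphM /= uE -/L {2}(divp_eq (L h) (L f)).
    by rewrite addrAC subrr add0r.
  apply/eqP; apply: contraT => nzr.
  have /asboolP/dmin : exists g,
      [/\ gev xi g = 0, L g != 0 & size (L g) = size (L h %% L f)%R].
    exists (h - u * f); rewrite -rE; split=> //.
    by rewrite rmorphB rmorphM /= xih xif mulr0 subr0.
  by rewrite -sf leqNgt ltn_modp nzf.
have [q LfE qE] := poly_drop1 (L0 f xif).
have q0 : q`_0 != 0.
  apply: contraNneq dPa => q0; rewrite -line_restr_coef1 -/L.
  have [u ->] := Lf_dvd P xiP.
  by rewrite LfE mulrA coefMX /= coefM big_ord1 q0 mulr0.
(* Either [q] is constant, or a root of it, nonzero as [q] does not vanish at 0, is the parameter of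
   a second point. *)
have [/eqP/size_poly1P[c c0 qc]|] := eqVneq (size q) 1%N.
  by right; exists f, c; rewrite -/L LfE qc.
case/closed_rootP => r qr; left; exists r.
  by apply: contraNneq q0 => r0; move: qr; rewrite r0 rootE horner_coef0.
move=> h /Lf_dvd[u Lh].
transitivity (L h).[r].
  by rewrite horner_line_restr; apply: eq_mmap => // i /=; rewrite mxE.
by rewrite Lh LfE !hornerM (rootP qr) mul0r mulr0.
Qed.

Section ProjectionStep.
Variables (m : nat) (i1 : 'I_m.+1) (b : 'I_m.+1 -> k) (xi : 'I_m.+1 -> K).
Local Notation w := (fun j => gev xi (proj_form i1 b j)).

(** Linear relations, equations and test polynomials for the projection are pulled back to [xi] by
    composing with the forms of the projection. *)
Lemma generic_proj : generic xi -> generic w.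
Proof.
move=> [free cone dense]; split.
- move=> c wc j.
  pose c' i := if unlift i1 i is Some j then c j else - \sum_j c j * b (lift i1 j).
  suff /free/(_ (lift i1 j)) : \sum_i iota (c' i) * xi i = 0 by rewrite /c' liftK.
  rewrite -[RHS]wc (bigD1_ord i1) //= /c' unlift_none rmorphN rmorph_sum mulNr mulr_suml.
  rewrite addrC -sumrB; apply: eq_bigr => l _.
  by rewrite liftK gev_proj_form mulrBr mulrA rmorphM.
- move=> f t; rewrite -gev_mcomp => /(cone _ t); rewrite gev_mcomp => e.
  rewrite -[RHS]e; apply: eq_mmap => // j.
  by rewrite !gev_proj_form mulrBr mulrCA.
- move=> h; rewrite -gev_mcomp => /dense[x [xix hx]].
  exists (\row_j (proj_form i1 b j).@[x 0]).
  have e f : f.@[(\row_j (proj_form i1 b j).@[x 0]) 0] = (mcomp (proj_form i1 b) f).@[x 0].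
    by rewrite meval_mcomp; apply: eq_mmap => // j /=; rewrite mxE.
  rewrite e; split=> // f; rewrite -gev_mcomp => /xix.
  by rewrite e.
Qed.

End ProjectionStep.

(** * Projection from a point [a] of the variety *)

Section ProjectionFromPoint.
Variables (n : nat) (xi : 'I_n.+2 -> K) (a : 'I_n.+2 -> k).
(** A coordinate other than 0, so that the projection sends [e0] to [e0]. *)
Let i1 : 'I_n.+2 := lift ord0 ord0.
Hypotheses (gxi : generic xi) (a1 : a i1 != 0).
Let b i := a i / a i1.
Local Notation w := (fun j => gev xi (proj_form i1 b j)).
(** The line [a + t w], with [w] placed in the hyperplane [x_i1 = 0], passes at [t = t0] through the
    multiple [t0 xi] of the generic point. *)
Let t0 := iota (a i1) / xi i1.

Let b1 : b i1 = 1. Proof. by rewrite /b divff. Qed.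

Lemma lift_i1_0 : lift i1 ord0 = ord0.
Proof. exact/val_inj. Qed.

Lemma e0_i1 : e0 i1 = 0. Proof. by []. Qed.

Lemma e0_lift_i1 j : e0 (lift i1 j) = e0 j.
Proof.
rewrite /e0; case: (unliftP ord0 j) => [l ->|->]; first by [].
by rewrite lift_i1_0 !eqxx.
Qed.

Lemma ext0_e0 i : ext0 i1 (@e0 n) i = e0 i.
Proof.
by rewrite /ext0; case: unliftP => [j ->|->] //=; rewrite e0_lift_i1.
Qed.

(** [f] on the line from [a] in an indeterminate direction, which is later set to [w], towards the
    generic point, or to [e0]. *)
Let gen_line (f : {mpoly k[n.+2]}) : {poly {mpoly k[n.+1]}} :=
  line_subst (@mpolyC n.+1 k) (@mpolyC n.+1 k \o a) (ext0 i1 (fun j => 'X_j)) f.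

Lemma root_gen_line f : gev xi f = 0 -> root (map_poly (gev w) (gen_line f)) t0.
Proof.
move=> xif; apply/rootP; rewrite map_line_subst horner_line_subst.
rewrite -[RHS](generic_cone gxi t0 xif); apply: eq_mmap => [c|i] /=.
  by rewrite mmapC.
rewrite mmapC rmorph_ext0 [in RHS](gev_proj_rec iota b1 xi i) mulrDr addrC.
have -> : t0 * (iota (b i) * xi i1) = iota (a i).
  by rewrite /t0 /b mulrCA divfK ?generic_neq0 // -rmorphM divfK.
congr (_ + _); rewrite mulrC; congr (_ * _).
by apply: eq_ext0 => j /=; rewrite mmapXU.
Qed.

Lemma spec_gen_line f : map_poly (meval (@e0 n)) (gen_line f) = line_restr a f.
Proof.
rewrite map_line_subst; apply: eq_mmap => [c|i] /=; first by rewrite mevalC.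
rewrite mevalC rmorph_ext0 -ext0_e0; congr (_ + _ *: _).
by apply: eq_ext0 => j /=; rewrite mevalXU.
Qed.

Lemma proj_t0 : t0 != 0.
Proof. by rewrite mulf_neq0 ?invr_eq0 ?generic_neq0 // fmorph_eq0. Qed.

(* [f] says that the line through [a] and [e0] meets the variety transversally, and
   only at [a]; hence [e0] is not in the closure of the projection from [a]. *)
Lemma projection_from_point f c d P :
  gev xi f = 0 -> c != 0 -> line_restr a f = c%:P * 'X ->
  P \is d.-homog -> gev xi P = 0 -> P.@[@e0 n.+1] != 0 ->
  (exists Q, gev w Q = 0 /\ Q.@[@e0 n] != 0) /\ forall i, cl w (xi i).
Proof.
move=> xif c0 Lf hP xiP Pe.
have F0 : (gen_line f)`_0 = 0.
  have <- : (f.@[a])%:MP = (gen_line f)`_0.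
    by rewrite line_subst_coef0 /meval rmorph_mmap; apply: eq_mmap.
  by rewrite -line_restr_coef0 Lf coefMX mpolyC0.
(* As [f] vanishes at [a], a factor ['X] splits off. The cofactor [F] becomes the constant [c] at
   [e0], and at [w] still has the nonzero root [t0]. *)
have [F FE Fcoef] := poly_drop1 F0.
have thF : map_poly (meval (@e0 n)) F = c%:P.
  apply: (mulIf (negbT (polyX_eq0 k))); rewrite -Lf -spec_gen_line FE rmorphM /=.
  by rewrite map_polyX.
have Ft0 : root (map_poly (gev w) F) t0.
  have := root_gen_line xif; rewrite FE rmorphM /= map_polyX rootM rootX.
  by rewrite (negbTE proj_t0) orbF.
split.
  have [sP cP] := line_subst_top (@mpolyC n.+1 k) (@mpolyC n.+1 k \o a)
    (ext0 i1 (fun j => 'X_j)) hP.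
  have Pd : meval (@e0 n) (gen_line P)`_d != 0.
    rewrite cP rmorph_mmap; apply: contra_neq Pe => <-.
    apply: eq_mmap => [x|i] /=; first by rewrite mevalC.
    rewrite rmorph_ext0 -ext0_e0.
    by apply: eq_ext0 => j /=; rewrite mevalXU.
  (* The parameter is eliminated between the equations from [f] and [P]. The result survives at
     [e0], where [F] is a nonzero constant and the equation from [P] keeps its degree. *)
  have [Q [wQ Qe]] := elimination c0 thF sP Pd Ft0 (root_gen_line xiP).
  by exists Q.
have clt0 : cl w t0.
  exists (map_poly (gev w) F); split=> //; last first.
    move=> i; rewrite coef_map; apply: gev_rgen => j; apply: rgen_mem.
    by exists j.
  (* The constant coefficient of [F] at [w] is the differential of [f] at [a], applied to [w]. It
     involves coordinate 0 with factor [c], so it is nonzero by linear independence, and [F] gives a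
     genuine equation of [t0]. *)
  have wF0 : gev w F`_0 = \sum_j iota ((f^`M(lift i1 j)).@[a]) * w j.
    rewrite Fcoef line_subst_coef1 rmorph_sum (bigD1_ord i1) //= /ext0 unlift_none.
    rewrite mulr0 rmorph0 add0r.
    by apply: eq_bigr => j _; rewrite liftK rmorphM /= mmapC mmapXU.
  apply/eqP => /polyP/(_ 0%N); rewrite coef_map coef0 /= wF0.
  move/(generic_free (generic_proj i1 b gxi))/(_ ord0).
  rewrite lift_i1_0 -line_restr_coef1 Lf coefCM coefX mulr1 => c0'.
  by rewrite c0' eqxx in c0.
have clx1 : cl w (xi i1).
  have -> : xi i1 = iota (a i1) * t0^-1.
    by rewrite /t0 invf_div mulrCA divff ?mulr1 // fmorph_eq0.
  by apply: acl_mul; [exact: acl_const | exact: acl_inv].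
move=> i; rewrite (gev_proj_rec iota b1 xi i); apply: acl_add; last first.
  by apply: acl_mul => //; exact: acl_const.
rewrite /ext0; case: unlift => [j|] /=; first by apply: acl_mem; exists j.
by rewrite -(rmorph0 iota); exact: acl_const.
Qed.

End ProjectionFromPoint.

Lemma lift_combination m (i1 : 'I_m.+1) (b : 'I_m.+1 -> k)
    (good : 'rV[k]_m -> Prop) (good' : 'rV[k]_m.+1 -> Prop) (s : seq (k * 'rV[k]_m)) :
  (forall x1, good x1 -> exists x, good' x /\ forall j, (proj_form i1 b j).@[x 0] = x1 0 j) ->
  (forall t, t \in s -> good t.2) ->
  exists s', [/\ size s' = size s, forall t, t \in s' -> good' t.2 &
    forall j, \sum_(t <- s') t.1 * (proj_form i1 b j).@[t.2 0] = \sum_(t <- s) t.1 * t.2 0 j].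
Proof.
move=> lift; elim: s => [|t s IHs] hs.
  by exists [::]; split=> // j; rewrite !big_nil.
have [|s' [ss' hs' es']] := IHs; first by move=> u us; apply: hs; rewrite inE us orbT.
have [x [xg xt]] := lift _ (hs t (mem_head _ _)).
exists ((t.1, x) :: s'); split=> [|u|j]; first by rewrite /= ss'.
  by rewrite inE => /orP[/eqP-> //|/hs'].
by rewrite !big_cons es' /= xt.
Qed.

(** Induction on [m]. The open condition [g] strengthens the claim, since the points found on a
    projection have to avoid the locus where lifting fails. [N0] stands for the dimension of the
    affine cone. *)
Theorem spanning_points N0 (f : nat -> K) m (xi : 'I_m.+1 -> K) g :
  (0 < N0)%N -> alg_indep iota N0 f -> generic xi ->
  (forall i, (i < N0)%N -> cl xi (f i)) ->
  (exists Q, gev xi Q = 0 /\ Q.@[@e0 m] != 0) -> gev xi g != 0 ->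
  exists s : seq (k * 'rV[k]_m.+1), [/\ (size s + N0 <= m.+2)%N,
    forall t, t \in s -> specializes iota xi t.2 /\ g.@[t.2 0] != 0 &
    forall i, \sum_(t <- s) t.1 * t.2 0 i = e0 i].
Proof.
move=> N0_gt0 fI; elim: m xi g => [|m IHm] xi g gxi xif [Q [xiQ Qe]] xig.
all: have xi_eta := algebraic_over_projection gxi xiQ Qe.
(* Since [e0] is off the variety, the coordinates other than 0 suffice up to algebraicity, so [N0]
   is at most their number; for [m = 0] this is absurd. *)
all: have leN0 : (N0 <= _)%N := leq_dim fI (fun i lt => acl_trans
  (fun _ '(ex_intro l e) => eq_ind_r _ (xi_eta l) e) (xif i lt)).
  by rewrite leqNgt N0_gt0 in leN0.
have [d [P [hP xiP Pe xidP]]] := nonvanishing_derivative gxi xiQ Qe.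
(* The condition [g] is ensured by one that does not involve coordinate 0, so that it persists along
   the line through [a] in direction [e0]. *)
pose W j : {mpoly k[m.+2]} := 'X_(lift ord0 j).
have [|G [WG hG]] := @algebraic_denominator _ _ iota _ _ xi W g _ xig.
  move=> i; apply: acl_subset (xi_eta i) => _ [j ->]; exists j.
  by rewrite /W mmapXU.
pose i1 : 'I_m.+2 := lift ord0 ord0.
have : gev xi (mcomp W G * P^`M(ord0) * 'X_i1) != 0.
  rewrite !rmorphM /= mmapXU gev_mcomp !mulf_neq0 //.
  exact: generic_neq0.
case/(generic_dense gxi) => a [xia].
rewrite !mevalM meval_mcomp mevalXU !mulf_eq0 !negb_or => /andP[/andP[Ga dPa] a1].
have ga := hG a xia Ga.
case: (line_dichotomy xia xiP dPa) => [[r r0 xir]|[h [c [xih c0 Lh]]]].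
  (* The second point of the line: [e0] is [(x - a) / r]. *)
  pose x : 'rV[k]_m.+2 := \row_i (a 0 i + e0 i * r).
  exists [:: (- r^-1, a); (r^-1, x)]; split.
  - by rewrite /= !addSn !ltnS.
  - move=> t; rewrite !inE => /orP[/eqP->|/eqP->] //=; split=> //.
    apply: hG => //; rewrite (_ : G.@[_] = G.@[fun j => (W j).@[a 0]]) //.
    by apply: eq_mmap => // j; rewrite !mevalXU mxE mul0r addr0.
  - move=> i; rewrite !big_cons big_nil /= mxE mulrDr mulNr addr0 addKr.
    by rewrite mulrCA mulVf ?mulr1.
pose b i := a 0 i / a 0 i1.
have b1 : b i1 = 1 by rewrite /b divff.
pose w j := gev xi (proj_form i1 b j).
have [[Q1 [wQ1 Q1e]] wxi] := projection_from_point gxi a1 xih c0 Lh hP xiP Pe.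
have [l [wl hl]] := lift_spec b1 (wxi i1).
(* The points of the projection must avoid [l = 0], to be liftable, and [G1 = 0], for [g] to be
   nonzero at their lifts. *)
have [G1 [wG1 hG1]] := algebraic_denominator wxi xig.
have [|||s [ss hs es]] := IHm w (G1 * l) (generic_proj i1 b gxi).
- move=> i /xif; apply: acl_trans => _ [j ->]; exact: wxi.
- by exists Q1.
- by rewrite rmorphM mulf_neq0.
have [|s' [ss' hs' es']] := @lift_combination _ i1 b
    (fun x1 => specializes iota w x1 /\ (G1 * l).@[x1 0] != 0)
    (fun x => specializes iota xi x /\ g.@[x 0] != 0) s _ hs.
  move=> x1 [wx1]; rewrite mevalM mulf_eq0 negb_or => /andP[G1x lx].
  have [x [xix xE]] := hl x1 wx1 lx; exists x; split=> //; split=> //.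
  apply: hG1 => //; rewrite (_ : G1.@[_] = G1.@[x1 0]) //.
  by apply: eq_mmap => // j; rewrite xE.
(* The error of the lifted combination is killed by the projection from [a], hence is a multiple of
   [a], and adding [a] to the points corrects it. *)
pose y i := \sum_(t <- s') t.1 * t.2 0 i - e0 i.
have yp j : (proj_form i1 b j).@[y] = 0.
  rewrite meval_proj_form /y e0_lift_i1 e0_i1 subr0 -es -es' mulr_sumr -!sumrB.
  by rewrite big1 // => t _; rewrite meval_proj_form; ring.
have yE i : y i = b i * y i1.
  rewrite [LHS](meval_proj_rec b1 y i) /ext0.
  by case: unlift => [j|] /=; rewrite ?yp add0r.
exists ((- y i1 / a 0 i1, a) :: s'); split.
- by rewrite /= ss' addSn.
- by move=> t; rewrite inE => /orP[/eqP->|/hs'].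
- move=> i; rewrite big_cons /=.
  have -> : \sum_(t <- s') t.1 * t.2 0 i = y i + e0 i by rewrite /y subrK.
  by rewrite (yE i) /b; ring.
Qed.

End Spanning.

(** * Projective varieties *)

Section PrimeChain.
Variables (k : fieldType) (B : comNzRingType) (K : fieldType).
Variables (j : {rmorphism k -> B}) (ev : {rmorphism B -> K}).
Variables (N : nat) (P : nat -> B -> Prop) (f : nat -> B).
Hypotheses
  (P_add : forall i x y, (i <= N)%N -> P i x -> P i y -> P i (x + y))
  (P_mul : forall i a x, (i <= N)%N -> P i x -> P i (a * x))
  (P_prime : forall i x y, (i <= N)%N -> P i (x * y) -> P i x \/ P i y)
  (P_sub : forall i x, (i < N)%N -> P i.+1 x -> P i x)
  (P_ker : forall x, ev x = 0 -> P N x)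
  (P_const : forall c, P 0%N (j c) -> c = 0)
  (Pf : forall i, (i < N)%N -> P i (f i))
  (nPf : forall i, (i < N)%N -> ~ P i.+1 (f i)).

Local Notation iota := (ev \o j).
Local Notation before i := (fun y => exists2 l, (l < i)%N & y = ev (f l)).

Lemma chain_ker i x : (i <= N)%N -> ev x = 0 -> P i x.
Proof.
move=> leiN x0; rewrite -(subKn leiN).
elim: (N - i)%N (leq_subr i N) => [|d IHd] ltdN; first by rewrite subn0; exact: P_ker.
apply: P_sub; first by rewrite ltn_subrL (leq_ltn_trans _ ltdN).
by rewrite subnSK //; apply/IHd/ltnW.
Qed.

Lemma chain_cong i x y : (i <= N)%N -> ev x = ev y -> P i x -> P i y.
Proof.
move=> leiN e Px; rewrite -(subrK x y) addrC; apply: P_add => //.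
by apply: chain_ker => //; rewrite rmorphB e subrr.
Qed.

Lemma rgen_image S y : (forall y, S y -> exists x, y = ev x) ->
  rgen iota S y -> exists x, y = ev x.
Proof.
move=> SI; elim=> [c|z /SI //|_ _ _ [x ->] _ [z ->]|_ _ _ [x ->] _ [z ->]].
- by exists (j c).
- by exists (x + z); rewrite rmorphD.
- by exists (x * z); rewrite rmorphM.
Qed.

Lemma before_image i y : rgen iota (before i) y -> exists x, y = ev x.
Proof. by apply: rgen_image => _ [l _ ->]; exists (f l). Qed.

(** Coefficients are removed one at a time. As [f i] lies in [P i], so does the constant one, which
    is then zero; as [f i] is not in the prime [P i.+1], the remaining factor is. *)
Lemma chain_poly0 i (q : {poly K}) x : (i < N)%N ->
  (forall x, rgen iota (before i) (ev x) -> P i x -> ev x = 0) ->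
  rgen_poly iota (before i) q -> ev x = q.[ev (f i)] -> P i.+1 x -> q = 0.
Proof.
move=> ltiN Ci; elim/poly_ind: q x => [//|p c IHp] x Sq xE Px.
have Sp : rgen_poly iota (before i) p.
  by move=> l; have := Sq l.+1; rewrite coefD coefMX coefC addr0.
have Sc : rgen iota (before i) c.
  by have := Sq 0%N; rewrite coefD coefMX coefC add0r.
have [h cE] := before_image Sc.
have [u pE] : exists u, p.[ev (f i)] = ev u.
  have [H HE] := choice (fun l => before_image (Sp l)).
  exists (\sum_(l < size p) H l * f i ^+ l).
  rewrite horner_coef rmorph_sum; apply: eq_bigr => l _.
  by rewrite HE rmorphM rmorphXn.
have {}xE : ev x = ev (u * f i + h).
  by rewrite xE hornerD hornerMX hornerC pE cE rmorphD rmorphM.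
have Puh := chain_cong ltiN xE Px.
have c0 : c = 0.
  rewrite cE; apply: Ci; first by rewrite -cE.
  have -> : h = (u * f i + h) + (- u) * f i by rewrite mulNr addrAC subrr add0r.
  apply: (P_add (ltnW ltiN)); first exact: P_sub.
  by apply: P_mul; [exact: ltnW | exact: Pf].
rewrite c0 addr0 (IHp u) ?mul0r //.
have : P i.+1 (u * f i).
  by apply: (chain_cong ltiN _ Puh); rewrite rmorphD -cE c0 addr0.
by case/(P_prime ltiN) => // /(nPf ltiN).
Qed.

(** Induction on [i]: only constants are left at [i = 0], and [chain_poly0] handles each further
    generator. *)
Lemma chain_trivial i x : (i <= N)%N -> rgen iota (before i) (ev x) ->
  P i x -> ev x = 0.
Proof.
elim: i x => [|i IHi] x leiN Sx Px.
  have [c xc] : exists c, ev x = ev (j c).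
    elim: Sx => [c|_ [l]|_ _ _ [c ->] _ [d ->]|_ _ _ [c ->] _ [d ->]] //.
    - by exists c.
    - by exists (c + d); rewrite !rmorphD.
    - by exists (c * d); rewrite !rmorphM.
  by rewrite xc (P_const (chain_cong leiN xc Px)) !rmorph0.
have : rgen iota (adjoin (before i) (ev (f i))) (ev x).
  apply: rgen_sub Sx => _ [l lti ->]; apply: rgen_mem.
  move: lti; rewrite ltnS leq_eqVlt => /orP[/eqP->|lti]; first by right.
  by left; exists l.
case/rgen_adjoin => q [Sq xE].
rewrite xE (chain_poly0 leiN _ Sq xE Px) ?horner0 // => y.
exact/IHi/ltnW.
Qed.

Lemma chain_alg_indep : alg_indep iota N (ev \o f).
Proof.
move=> i ltiN [q [q0 Sq qf]]; case/eqP: q0.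
apply: (@chain_poly0 i q 0 ltiN) => //.
- by move=> x; exact/chain_trivial/ltnW.
- by rewrite rmorph0 (rootP qf).
- by apply: chain_ker; rewrite ?rmorph0.
Qed.

End PrimeChain.

(** * Closed sets of lines and their ideals *)

Section Geometry.
Variables (k : closedFieldType) (V : vectType k).
Hypothesis pchark : [pchar k] =i pred0.
Local Notation D := (\dim {:V}).
Local Notation form := {mpoly k[D]}.
Implicit Types (f g : form) (l : proj V) (Z : set (proj V)).

Definition coords (v : V) : 'I_D -> k := fun i => coord (vbasis {:V}) i v.

Lemma peval_scale f (c : k) v : peval f (c *: v) = f.@[fun i => c * coords v i].
Proof. by apply: eq_mmap => // i; rewrite linearZ. Qed.

Lemma pihomog_vanish f v d :
  (forall c, peval f (c *: v) = 0) -> peval (pihomog mdeg d f) v = 0.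
Proof.
move=> fv; apply: (@gev_pihomog k k (idfun : {rmorphism k -> k}) pchark) => t.
by rewrite -[RHS](fv t%:R) peval_scale.
Qed.

Lemma line_vanish l : exists v, [/\ v != 0, v \in (l : {vspace V}) &
  forall f, vanishes_at f l <-> forall c, peval f (c *: v) = 0].
Proof.
case: l => L dimL; have L0 : L != 0%VS by rewrite -dimv_eq0 (eqP dimL).
exists (vpick L); split; rewrite ?vpick0 ?memv_pick // => f.
have LE : L = <[vpick L]>%VS.
  apply/esym/eqP; rewrite eqEdim -memvE memv_pick (eqP dimL).
  by rewrite dim_vline vpick0 L0.
split=> [fL c|fL v]; first by apply: fL; rewrite /= memvZ ?memv_pick.
by rewrite /= LE => /vlineP[c ->].
Qed.

Lemma line_eq l v : v \in (l : {vspace V}) -> v != 0 -> l = <[v]>%VS :> {vspace V}.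
Proof.
case: l => L dimL /= Lv v0; apply/esym/eqP.
by rewrite eqEdim -memvE Lv (eqP dimL) dim_vline v0.
Qed.

Lemma vanishes_homog f l :
  vanishes_at f l <-> forall d, vanishes_at (pihomog mdeg d f) l.
Proof.
split=> [fl d v lv|fl v lv].
  by apply: pihomog_vanish => c; apply: fl; rewrite memvZ.
rewrite /peval (@pihomog_partitionE _ _ mdeg _ f (leqnn _)) rmorph_sum big1 //=.
by move=> d _; exact: fl.
Qed.

(** On a line, vanishing means that a polynomial in the scaling parameter is zero, and [{poly k}] is
    a domain. *)
Lemma vanishes_prime f g l :
  vanishes_at (f * g) l -> vanishes_at f l \/ vanishes_at g l.
Proof.
have [v [_ _ vE]] := line_vanish l; rewrite !{}vE => fg.
pose L := line_subst (idfun : {rmorphism k -> k}) (fun=> 0) (coords v).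
have LE h c : (L h).[c] = peval h (c *: v).
  by rewrite horner_line_subst peval_scale; apply: eq_mmap => // i; rewrite add0r mulrC.
have : L f * L g = 0.
  rewrite -rmorphM; apply: poly_nat_roots => // t.
  by rewrite -[LHS]/((L (f * g)).[t%:R]) LE.
by move/eqP; rewrite mulf_eq0 => /orP[] /eqP L0; [left|right] => c;
  rewrite -LE L0 horner0.
Qed.

(** The ideal of the affine cone over [Z]. Its members need not be forms, so that it is an ordinary
    ideal, with a residue field when [Z] is irreducible. *)
Definition vanishing Z f := forall l, Z l -> vanishes_at f l.

(** The homogeneous components of [f] serve as equations in place of [f]. *)
Lemma closed_restrict Z f :
  zariski_closed Z -> zariski_closed (Z `&` [set l | vanishes_at f l]).
Proof.
move=> [S [Shom ->]].
exists (S `|` [set g | exists d, g = pihomog mdeg d f]); split.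
  by move=> g [/Shom //|[d ->]]; exists d; exact: pihomogP.
apply/seteqP; split=> l /=.
  by move=> [Sl /vanishes_homog fl] g [/Sl //|[d ->]].
move=> h; split=> [g Sg|]; first by apply: h; left.
by apply/vanishes_homog => d; apply: h; right; exists d.
Qed.

Lemma vanishing_prime Z f g :
  irreducible_closed Z -> vanishing Z (f * g) -> vanishing Z f \/ vanishing Z g.
Proof.
move=> [Zcl _ Zirr] fg.
have [|e|e] := Zirr _ _ (closed_restrict f Zcl) (closed_restrict g Zcl).
- apply/seteqP; split=> l /=; last by case=> -[].
  by move=> Zl; case: (vanishes_prime (fg l Zl)) => h; [left|right].
- by left=> l; rewrite e => -[].
- by right=> l; rewrite e => -[].
Qed.

Lemma vanishing_add Z f g : vanishing Z f -> vanishing Z g -> vanishing Z (f + g).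
Proof.
move=> Zf Zg l Zl v lv; have := Zf l Zl v lv; have := Zg l Zl v lv.
by rewrite /peval mevalD => -> ->; rewrite addr0.
Qed.

Lemma vanishing_mul Z f g : vanishing Z g -> vanishing Z (f * g).
Proof.
move=> Zg l Zl v lv; have := Zg l Zl v lv.
by rewrite /peval mevalM => ->; rewrite mulr0.
Qed.

Lemma closed_separate Z l : zariski_closed Z -> ~ Z l ->
  exists f, [/\ exists d, f \is d.-homog, vanishing Z f & ~ vanishes_at f l].
Proof.
move=> [S [Shom ZE]] nZl.
apply: contra_notP nZl => h; rewrite ZE => f Sf; apply: contra_notP h => nfl.
exists f; split=> //; first exact: Shom.
by move=> l'; rewrite ZE => /(_ f Sf).
Qed.

Lemma basis_from_vector v N : v != 0 -> D = N.+1 ->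
  exists e : N.+1.-tuple V, basis_of {:V} e /\ e`_0 = v.
Proof.
move=> v0 dimV; pose U := <[v]>%VS.
have eB : basis_of {:V} (v :: vbasis U^C).
  rewrite -(addv_complf U) -cat1s; apply: cat_basis.
  - by apply/directv_addP; exact: capv_compl.
  - exact: seq1_basis.
  - exact: vbasisP.
have eS : size (v :: vbasis U^C) == N.+1.
  by rewrite -dimV (@vector.size_basis _ _ _ _ (in_tuple (v :: vbasis U^C)) eB).
by exists (Tuple eS).
Qed.

(** * The generic point of the cone over [X] *)

Section GenericVector.
Variables (N : nat) (e : N.+1.-tuple V) (X : set (proj V)).
Variables (K : fieldType) (ev : {rmorphism form -> K}).
Hypotheses (eB : basis_of {:V} e) (Xcl : zariski_closed X).
Hypothesis evP : forall f, ev f = 0 <-> vanishing X f.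
Hypothesis Xnd : ~ in_hyperplane X.

Definition base_inc : {rmorphism k -> K} := ev \o @mpolyC D k.

(** Coordinates are changed from [vbasis] to a basis [e], later adapted to [p]; [linform] and
    [backform] are the two substitutions. *)
Definition linform j : form := \sum_(i < D) coord e j (vbasis {:V})`_i *: 'X_i.
Definition vec (x : 'rV[k]_N.+1) : V := \sum_(j < N.+1) x 0 j *: e`_j.
Definition backform i : {mpoly k[N.+1]} := \sum_(j < N.+1) coords e`_j i *: 'X_j.
(** Residue classes of the coordinate functions of [e] modulo the ideal of [X]. *)
Definition genvec j : K := ev (linform j).

Lemma peval_linform j v : peval (linform j) v = coord e j v.
Proof.
rewrite {2}(coord_vbasis (memvf v)) linear_sum /peval rmorph_sum.
by apply: eq_bigr => i _; rewrite linearZ /= mevalZ mevalXU mulrC.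
Qed.

Lemma meval_backform i (x : 'rV[k]_N.+1) : (backform i).@[x 0] = coords (vec x) i.
Proof.
rewrite [RHS]linear_sum [LHS]rmorph_sum; apply: eq_bigr => j _.
by rewrite /= mevalZ mevalXU linearZ /= mulrC.
Qed.

Lemma meval_mcomp_backform f (x : 'rV[k]_N.+1) : (mcomp backform f).@[x 0] = peval f (vec x).
Proof. by rewrite meval_mcomp; apply: eq_mmap => // i; exact: meval_backform. Qed.

Lemma peval_mcomp_linform h v :
  peval (mcomp linform h) v = h.@[fun j => coord e j v].
Proof. by rewrite /peval meval_mcomp; apply: eq_mmap => // j; exact: peval_linform. Qed.

Lemma gev_genvec h : mmap base_inc genvec h = ev (mcomp linform h).
Proof. by rewrite [RHS]rmorph_mmap. Qed.

Lemma vec_coord v : vec (\row_j coord e j v) = v.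
Proof.
rewrite [RHS](coord_basis eB (memvf v)); apply: eq_bigr => j _.
by rewrite mxE.
Qed.

Lemma gev_backform f : mmap base_inc genvec (mcomp backform f) = ev f.
Proof.
rewrite gev_genvec; apply/eqP; rewrite -subr_eq0 -rmorphB; apply/eqP/evP => l _ v _.
rewrite [LHS]mevalB -/(peval _ v) -/(peval f v) peval_mcomp_linform.
suff -> : (mcomp backform f).@[fun j => coord e j v] = peval f v by rewrite subrr.
rewrite -[in RHS](vec_coord v) -meval_mcomp_backform.
by apply: eq_mmap => // j /=; rewrite mxE.
Qed.

Lemma spec_vec x l : specializes base_inc genvec x -> vec x \in (l : {vspace V}) ->
  vec x != 0 -> X l.
Proof.
move=> gx lx x0; have [S [Shom XE]] := Xcl.
rewrite XE => f Sf v lv.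
have xf : peval f (vec x) = 0.
  rewrite -meval_mcomp_backform; apply: gx; rewrite gev_backform.
  by apply/evP => l'; rewrite XE => /(_ f Sf).
have [d fd] := Shom f Sf.
move: lv; rewrite (line_eq lx x0) => /vlineP[c ->].
by rewrite peval_scale /meval (homog_mmap _ _ _ fd) [X in _ * X]xf mulr0.
Qed.

Lemma vec_spec l v : X l -> v \in (l : {vspace V}) ->
  specializes base_inc genvec (\row_j coord e j v).
Proof.
move=> Xl lv h; rewrite gev_genvec => /evP/(_ l Xl v lv).
rewrite peval_mcomp_linform => <-; apply: eq_mmap => // j /=; exact: mxE.
Qed.

Lemma ev_mmap f : mmap base_inc (fun i => ev 'X_i) f = ev f.
Proof.
elim/mpoly_ring_ind: f => [c|i|p q pE qE|p q pE qE].
- by rewrite mmapC.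
- by rewrite mmapXU.
- by rewrite !rmorphD /= pE qE.
- by rewrite !rmorphM /= pE qE.
Qed.

Lemma linform_homog j : linform j \is 1.-homog.
Proof. by apply: rpred_sum => i _; rewrite rpredZ // dhomogX /= mdeg1. Qed.

Lemma hyperplane_lker (phi : 'Hom(V, k^o)) v :
  phi v != 0 -> (\dim (lker phi)).+1 = D.
Proof.
move=> pv; rewrite -(limg_ker_dim phi fullv) capfv -addn1; congr (_ + _)%N.
apply/eqP; rewrite eqn_leq; apply/andP; split.
  by rewrite lt0n dimv_eq0; apply: contraNneq pv => img0;
    rewrite -memv0 -img0 memv_img ?memvf.
by apply: leq_trans (dimvS (subvf _)) _; rewrite dimvf.
Qed.

(** A linear relation would put [X] in a hyperplane; the cone property is homogeneity of the ideal;
    a polynomial outside the ideal is nonzero at some vector over [X]. *)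
Lemma generic_genvec : generic base_inc genvec.
Proof.
split.
- move=> c cg j; apply/eqP; apply: contraT => cj; case: Xnd.
  have lin : linear (fun v : V => \sum_j c j * coord e j v : k^o).
    move=> t u v; rewrite scaler_sumr -big_split /=; apply: eq_bigr => i _.
    by rewrite linearP /= mulrDr mulrCA.
  pose phi : {linear V -> k^o} := HB.pack (fun v : V => \sum_j c j * coord e j v : k^o)
    (GRing.isLinear.Build _ _ _ _ _ lin).
  exists (lker (linfun phi)); split.
    apply: (@hyperplane_lker _ e`_j); rewrite lfunE /= (bigD1 j) //= big1 => [|i neij].
      by rewrite (coord_free _ _ (basis_free eB)) eqxx mulr1 addr0.
    by rewrite (coord_free _ _ (basis_free eB)) eq_sym (negbTE neij) mulr0.
  move=> l Xl; apply/subvP => v lv; rewrite memv_ker lfunE /=; apply/eqP.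
  have : ev (\sum_j c j *: linform j) = 0.
    rewrite -[RHS]cg rmorph_sum; apply: eq_bigr => i _.
    by rewrite -mul_mpolyC rmorphM.
  move/evP => /(_ l Xl v lv); rewrite /peval rmorph_sum => ve.
  rewrite -[RHS]ve; apply: eq_bigr => i _.
  by rewrite /= mevalZ -peval_linform.
- move=> f t; rewrite gev_genvec => /evP fX.
  pose h := mcomp linform f.
  have -> : mmap base_inc (fun j => t * genvec j) f =
      mmap base_inc (fun i => t * ev 'X_i) h.
    rewrite gev_mcomp; apply: eq_mmap => // j.
    by rewrite (homog_mmap _ _ _ (linform_homog j)) ev_mmap expr1.
  rewrite (@pihomog_partitionE _ _ mdeg _ h (leqnn _)) rmorph_sum big1 //= => d _.
  rewrite (homog_mmap _ _ _ (pihomogP mdeg d h)) ev_mmap.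
  suff -> : ev (pihomog mdeg d h) = 0 by rewrite mulr0.
  by apply/evP => l /fX /vanishes_homog.
- move=> h; rewrite gev_genvec => nh.
  have : ~ vanishing X (mcomp linform h) by move/evP/eqP; exact/negP.
  case/existsNP => l /not_implyP[Xl] /existsNP[v /not_implyP[lv hv]].
  exists (\row_j coord e j v); split; first exact: vec_spec lv.
  apply/eqP => h0; apply: hv; rewrite peval_mcomp_linform -[RHS]h0.
  by apply: eq_mmap => // j /=; rewrite mxE.
Qed.

End GenericVector.

Theorem Xrank_bound N n (X : set (proj V)) (p : proj V) :
  D = N.+1 -> irreducible_closed X -> irreducible_chain X n -> ~ in_hyperplane X ->
  exists r, (r <= N.+1 - n)%N /\ spanned_by X p r.
Proof.
move=> dimV Xirr [Z [Zirr Zlt]] Xnd; have [Xcl [l0 Xl0] _] := Xirr.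
have [v [v0 pv _]] := line_vanish p.
have [e [eB ev0]] := basis_from_vector v0 dimV.
have [|||||K [ev evP]] := @prime_ideal_field form (vanishing X).
- by move=> l _ u _; rewrite /peval meval0.
- move=> h; have := h l0 Xl0 0 (mem0v _); rewrite /peval meval1.
  by apply/eqP; exact: oner_neq0.
- exact: vanishing_add.
- by move=> a x; exact: vanishing_mul.
- by move=> x y; exact: vanishing_prime.
have gxi := generic_genvec eB evP Xnd.
(* The ideal of the origin is put before the ideals of [Z 0, ..., Z n]. This gives [n.+1]
   independent elements, matching the dimension of the cone. *)
pose P i : form -> Prop := if i is i'.+1 then vanishing (Z i') else fun f => f.@[fun=> 0] = 0.
have exf i : exists f, (i < n.+1)%N -> P i f /\ ~ P i.+1 f.
  have [lti|lei] := ltnP i n.+1; last by exists 0.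
  case: i lti => [_|i lti].
    have [[_ [l Zl] _] _] := Zirr 0%N (leq0n n).
    have [u [u0 lu _]] := line_vanish l.
    have [i ui] : exists i, coords u i != 0.
      apply/existsP; apply: contraNT u0; rewrite negb_exists => /forallP h.
      rewrite (coord_vbasis (memvf u)) big1 // => i _.
      by have := h i; rewrite negbK /coords => /eqP ->; rewrite scale0r.
    exists 'X_i => _; split; first by rewrite /= mevalXU.
    by move/(_ l Zl u lu)/eqP; rewrite /peval mevalXU; exact/negP.
  have [_ /existsNP[l /not_implyP[Zl nZl]]] := Zlt i lti.
  have [[Zcl _ _] _] := Zirr i (ltnW lti).
  have [h [_ Zh nh]] := closed_separate Zcl nZl.
  by exists h => _; split=> // /(_ l Zl).
have [f hf] := choice exf.
have fI : alg_indep (base_inc ev) n.+1 (ev \o f).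
  have Z0 : Z 0%N !=set0 by have [[]] := Zirr 0%N (leq0n n).
  apply: (@chain_alg_indep _ _ _ (@mpolyC D k) ev n.+1 P f).
  - move=> [|i] x y _ /=; last exact: vanishing_add.
    by move=> x0 y0; rewrite mevalD x0 y0 addr0.
  - move=> [|i] a x _ /=; last exact: vanishing_mul.
    by move=> x0; rewrite mevalM x0 mulr0.
  - move=> [|i] x y lti /=; last by apply: vanishing_prime; case: (Zirr i lti).
    by move/eqP; rewrite mevalM mulf_eq0 => /orP[] /eqP; [left|right].
  - move=> [|i] x lti /= Zx; last by move=> l /(proj1 (Zlt i lti)); exact: Zx.
    have [l Zl] := Z0; rewrite -[RHS](Zx l Zl 0 (mem0v _)).
    by apply: eq_mmap => // i; rewrite /= linear0.
  - by move=> x /evP Xx l /(proj2 (Zirr n (leqnn n))); exact: Xx.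
  - by move=> c /=; rewrite mevalC.
  - by move=> i /hf[].
  - by move=> i /hf[].
have xif i : (i < n.+1)%N ->
    acl (base_inc ev) (fun y => exists j, y = genvec e ev j) ((ev \o f) i).
  move=> _ /=; rewrite -(gev_backform eB evP); apply: cl_gev => j.
  by apply: acl_mem; exists j.
(* A point of [X] spans itself, and [1 <= N.+1 - n] because [n.+1] independent elements need [n.+1]
   coordinates. *)
have [Xp|nXp] := EM (X p).
  exists 1%N; split; first by rewrite subn_gt0; exact: leq_dim fI xif.
  by exists (fun=> p); split=> //; rewrite big_ord1.
have vecE : vec e (\row_j @e0 k N j) = v.
  rewrite /vec -[RHS]ev0 (bigD1 ord0) //= mxE /e0 eqxx scale1r big1 ?addr0 // => i.
  by move=> /negbTE i0; rewrite mxE i0 scale0r.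
have [Q [xiQ Qe]] : exists Q,
    mmap (base_inc ev) (genvec e ev) Q = 0 /\ Q.@[@e0 k N] != 0.
  have [h [[d hd] Xh nh]] := closed_separate Xcl nXp.
  exists (mcomp (backform e) h); split.
    by rewrite (gev_backform eB evP); apply/evP.
  apply/eqP => h0; apply: nh => u; rewrite (line_eq pv v0) => /vlineP[c ->].
  rewrite peval_scale /meval (homog_mmap _ _ _ hd) -/(meval _ _) -/(peval h v).
  suff -> : peval h v = 0 by rewrite mulr0.
  rewrite -[RHS]h0 -vecE -meval_mcomp_backform.
  by apply: eq_mmap => // j /=; rewrite mxE.
(* The condition [g] is coordinate 0: its being nonzero makes the vectors nonzero, so that they span
   lines. *)
have g0 : mmap (base_inc ev) (genvec e ev) 'X_ord0 != 0.
  by rewrite mmapXU; exact: (generic_neq0 _ gxi).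
have [s [ss hs es]] :=
  spanning_points pchark (ltn0Sn n) fI gxi xif (ex_intro _ Q (conj xiQ Qe)) g0.
exists (size s); split.
  (* The bound obtained is [size s + n.+1 <= N.+2]; [n <= N] guards the truncated subtraction. *)
  by rewrite leq_subRL; [rewrite addnC -ltnS -addnS | exact/ltnW/(leq_dim fI xif)].
have exq t : exists q : proj V, t \in s -> X q /\ vec e t.2 \in (q : {vspace V}).
  have [st|] := boolP (t \in s); last by exists p.
  have [tspec t0] := hs t st; rewrite mevalXU in t0.
  have tv : vec e t.2 != 0.
    apply: contraNneq t0 => t0.
    have := coord_sum_free (fun j => t.2 0 j) ord0 (basis_free eB).
    by rewrite -/(vec e t.2) t0 linear0 => <-.
  have dt : \dim <[vec e t.2]>%VS == 1%N by rewrite dim_vline tv.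
  exists (ProjPoint dt) => _; split; last exact: memv_line.
  exact: (spec_vec eB Xcl evP tspec (l := ProjPoint dt) (memv_line _) tv).
have [q hq] := choice exq.
exists (fun i => q (nth (0, 0) s i)); split=> [i|].
  by have [] := hq _ (mem_nth (0, 0) (ltn_ord i)).
rewrite (line_eq pv v0) -memvE.
have -> : v = \sum_(i < size s) (nth (0, 0) s i).1 *: vec e (nth (0, 0) s i).2.
  transitivity (\sum_(t <- s) t.1 *: vec e t.2); last by rewrite (big_nth (0, 0)) big_mkord.
  rewrite -vecE; under [RHS]eq_bigr => t _ do rewrite scaler_sumr.
  rewrite exchange_big; apply: eq_bigr => j _; rewrite mxE -es scaler_suml.
  by apply: eq_bigr => t _; rewrite scalerA.
apply: memv_sumr => i _; apply: memvZ.
by have [] := hq _ (mem_nth (0, 0) (ltn_ord i)).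
Qed.

End Geometry.

Theorem proposition5p1 (R : realType) (V : vectType R[i]) (N n : nat)
  (dimV : \dim {:V} = N.+1)
  (X : set (proj V))
  (X_irr : irreducible_closed X)
  (X_dim : has_dimension X n)
  (X_nondeg : ~ in_hyperplane X)
  (p : proj V) :
  exists r : nat, is_Xrank X p r /\ (r <= N.+1 - n)%N.
Proof.
have [r0 [ler0 Xr0]] := Xrank_bound (@Num.Theory.pchar_num R[i]) p dimV X_irr
  (proj1 X_dim) X_nondeg.
have exr : exists r, `[< spanned_by X p r >] by exists r0; apply/asboolP.
case: (ex_minnP exr) => r /asboolP Xr rmin; exists r; split.
  by split=> // s Xs; apply/rmin/asboolP.
by apply: leq_trans ler0; apply/rmin/asboolP.
Qed.
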